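(* Suppose that: (1) the disturbance $(w_t)_{t\in\mathbb{N}_0}$ is an i.i.d. random process with mean $\mu_{w_k}$ and covariance matrix $\Sigma_{w_k}$ (which can be computed from data); (2) there is $\alpha>0$ with $\int_\Xi \exp(\|\xi\|^\alpha)\,\mathbb{Q}(\mathrm{d}\xi)<\infty$ for the distributions $\mathbb{Q}\in\mathcal{M}(\Xi)$ under consideration; (3) the distributions in $\mathcal{M}(\Xi)$ are supported on the polytope $\Xi=\{\xi\in\mathbb{R}^{n_\xi}: C_\xi\xi\le d_\xi\}$. Then the distributionally robust optimal control problem $$\inf_{H_N}\ \sup_{\mathbb{Q}\in\mathbb{B}_\varepsilon(\widehat{\mathbb{P}}_{N_s})}\mathbb{E}_{\mathbb{Q}}\Big[\sum_{t=0}^{N-1}\beta^t\big(x_{k+t}^\top Qx_{k+t}+u_{k+t}^\top Ru_{k+t}\big)+\beta^Nx_{k+N}^\top Q_fx_{k+N}\Big]$$ $$\text{s.t. }\ x_{t+1}=Ax_t+Bu_t+Cw_t,\ \text{state at time } k \text{ equal to } x,\qquad \sup_{\mathbb{Q}\in\mathbb{B}_\varepsilon(\widehat{\mathbb{P}}_{N_s})}\mathbb{E}^{\mathbb{Q}}[\ell_j(\xi,H_N)]\le U_j\quad \forall j\le N_b,$$ over purified-output-based affine control laws $H_N$, with the type-1 Wasserstein ball $\mathbb{B}_\varepsilon(\widehat{\mathbb{P}}_{N_s})$ of radius $\varepsilon$ around the empirical distribution of $N_s$ samples, can be equivalently reformulated (the objective functions agree, and the constraints on $H_N$ agree once the auxiliary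 variables are projected out) as the finite-dimensional convex cone program $$\begin{array}{rl}\displaystyle\inf_{H_N,\lambda_j,s_{ij},\gamma_{ijt}} & \operatorname{Tr}\{M(H_N)\,\Sigma_w\}+\mu_w^\top M(H_N)\,\mu_w\\[1mm] \text{s.t.} & \lambda_j\varepsilon+\frac1{N_s}\sum_{i=1}^{N_s}s_{ij}\le U_j,\\[1mm] & b_{tj}+\langle a_{tj},\widehat\xi_i\rangle+\langle\gamma_{ijt},d_\xi-C_\xi\widehat\xi_i\rangle\le s_{ij},\\[1mm] & \|C_\xi^\top\gamma_{ijt}-a_{tj}\|_*\le\lambda_j,\quad \gamma_{ijt}\ge0,\\[1mm] & \forall i\le N_s,\ \forall j\le N_b,\ \forall\, 1\le t\le N,\end{array}$$ where $M(H_N)=(\tilde C_x+B_x\tilde H_N)^\top J_x(\tilde C_x+B_x\tilde H_N)+\tilde H_N^\top J_u\tilde H_N$, and $a_{tj}$ (depending on $H_N$) is the row of $B_x\tilde H_N+\tilde C_x$ with index $tn_x+m(j)$ restricted to columns $2,\dots,Nn_w+1$, and $b_{tj}$ is the entry of $B_x\tilde H_N+\tilde C_x$ in row $tn_x+m(j)$ and column $1$.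
   Context: System: $x_{t+1}=Ax_t+Bu_t+Cw_t$, $y_t=Dx_t+Ew_t$, with $x_t\in\mathbb{R}^{n_x}$, $u_t\in\mathbb{R}^{n_u}$, $y_t\in\mathbb{R}^{n_y}$, $w_t\in\mathbb{R}^{n_w}$; the prediction window is $k,\dots,k+N$, and $x$ is the state at the start $k$ of the window. Control laws: let $\hat x$, $\hat y$ be the nominal model $\hat x_{t+1}=A\hat x_t+Bu_t$, $\hat y_t=D\hat x_t$, started at $0$ at the beginning of the window, and $v_t=y_t-\hat y_t$ (purified output). A purified-output-based (POB) affine control law is $u_t=h_t+\sum_{\tau=k}^tH_{t,\tau}v_\tau$, $t\in[k,k+N-1]$. It is collected in the matrix $H_N=[\,h\ \ H\,]\in\mathbb{R}^{Nn_u\times(1+Nn_y)}$, $h$ being the stacked $h_t$ and $H$ the block lower triangular matrix of the $H_{t,\tau}$. Stacked form: $\xi=w_{[k:k+N-1]}=(w_k^\top,\dots,w_{k+N-1}^\top)^\top\in\mathbb{R}^{n_\xi}$, $n_\xi=Nn_w$, and $\tilde w=(1,\xi^\top)^\top$. Write $x_{[k:k+N]}=A_xx+B_xu_{[k:k+N-1]}+C_x\xi$ and $y_{[k:k+N-1]}=A_yx+B_yu_{[k:k+N-1]}+(C_y+E_y)\xi$ for the stacked dynamics and outputs obtained by iterating the system (so $E_y=\operatorname{diag}(E,\dots,E)$). Put $\tilde C_x=[A_xx\ \ C_x]$, $\tilde C_y=\begin{bmatrix} 0 & 0 \\ A_y x & C_y \end{bmatrix}$, $\tilde E_y=\begin{bmatrix}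 1 & 0 \\ 0 & E_y \end{bmatrix}$, $\tilde H_N=H_N(\tilde C_y+\tilde E_y)$. Then $u_{[k:k+N-1]}=\tilde H_N\tilde w$ and $x_{[k:k+N]}=(B_x\tilde H_N+\tilde C_x)\tilde w$. Cost data: $\beta\in(0,1]$, $Q,Q_f$ symmetric positive semidefinite, $R$ symmetric positive definite, $J_x=\operatorname{diag}(\operatorname{diag}(\beta^0,\dots,\beta^{N-1})\otimes Q,\ \beta^NQ_f)$, $J_u=\operatorname{diag}(\beta^0,\dots,\beta^{N-1})\otimes R$. $\mu_w$ and $\Sigma_w$ are the mean and covariance of the extended disturbance vector $\tilde w$ determined by the i.i.d. disturbance with mean $\mu_{w_k}$ and covariance $\Sigma_{w_k}$. Constraints: there are $N_b$ state constraints per sampling time; the $j$-th bounds from above by $U_j\in\mathbb{R}$ the $m(j)$-th component of the state, and $\ell_j(\xi,H_N)=\max_{1\le t\le N}[x_{[k:k+N]}]_{tn_x+m(j)}$, where $[\cdot]_i$ is the $i$-th entry (so entry $tn_x+m(j)$ is the $m(j)$-th component of $x_{k+t}$). Ambiguity set: $\mathcal{M}(\Xi)$ is the set of probability distributions supported on $\Xi$ with finite expected norm. For a norm $\|\cdot\|$ on $\mathbb{R}^{n_\xi}$ with dual norm $\|\cdot\|_*$, $d_{\mathrm W}(\mathbb{Q}_1,\mathbb{Q}_2)=\inf_\Pi\int_{\Xi^2}\|\xi_1-\xi_2\|\,\Pi(\mathrm{d}\xi_1,\mathrm{d}\xi_2)$, the infimum over couplings $\Pi$ of $\mathbb{Q}_1,\mathbb{Q}_2$.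 $\widehat{\mathbb{P}}_{N_s}=\frac1{N_s}\sum_{i=1}^{N_s}\delta_{\widehat\xi_i}$ is the empirical distribution of the training samples $\widehat\xi_1,\dots,\widehat\xi_{N_s}\in\Xi$ (each a disturbance sequence of length $N$), and $\mathbb{B}_\varepsilon(\widehat{\mathbb{P}}_{N_s})=\{\mathbb{Q}\in\mathcal{M}(\Xi):d_{\mathrm W}(\widehat{\mathbb{P}}_{N_s},\mathbb{Q})\le\varepsilon\}$ with $\varepsilon>0$.
   Formalization: In the objective, the supremum is only over laws in the ball under which the disturbance is i.i.d. with the given mean and covariance; the true law of the disturbance window is assumed to lie in the ball; the ball contains only laws satisfying the exponential moment bound (2). *)

(* Defs.v *)
From HB Require Import structures.
From mathcomp Require Import all_boot all_order all_algebra.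
From mathcomp Require Import all_classical all_reals all_analysis.

Set Implicit Arguments.
Unset Strict Implicit.
Unset Printing Implicit Defensive.

Import Order.TTheory GRing.Theory Num.Theory.
Import numFieldNormedType.Exports.

Local Open Scope classical_set_scope.
Local Open Scope ring_scope.

(* Dimension N * n of a vector stacked from N blocks of size n, in the form
   used by the block matrices \mxcol, \mxblock and \mxdiag. *)
Notation stk N n := (\sum_(i < N) n)%N.

(* R^n with its Borel sigma-algebra. *)
Notation borelV R n := (g_sigma_algebraType (@open 'cV[R]_n)).

(** Vectors, quadratic forms, norms *)

Section vectors.
Variable R : realType.

Definition dotv n (a b : 'cV[R]_n) : R := (a^T *m b) 0 0.

Definition qform n (S : 'M[R]_n) (z : 'cV[R]_n) : R := (z^T *m S *m z) 0 0.

Definition sym_psd n (S : 'M[R]_n) : Prop :=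
  S^T = S /\ forall z, 0 <= qform S z.

Definition sym_pd n (S : 'M[R]_n) : Prop :=
  S^T = S /\ forall z, z != 0 -> 0 < qform S z.

Definition is_norm n (nrm : 'cV[R]_n -> R) : Prop :=
  [/\ forall x y, nrm (x + y) <= nrm x + nrm y,
      forall c x, nrm (c *: x) = `|c| * nrm x &
      forall x, nrm x = 0 -> x = 0].

Definition dual_norm n (nrm : 'cV[R]_n -> R) (z : 'cV[R]_n) : R :=
  sup [set dotv z x | x in [set x | nrm x <= 1]].

(* t-th block, as a function of a natural number t (0 if t >= N) *)
Definition block N n (v : 'cV[R]_(stk N n)) (t : nat) : 'cV[R]_n :=
  oapp (fun i : 'I_N => submxcol v i) 0 (insub t).

Definition polytope n q (Cxi : 'M[R]_(q, n)) (dxi : 'cV[R]_q)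
    : set 'cV[R]_n :=
  [set xi | forall i, (Cxi *m xi) i 0 <= dxi i 0].

End vectors.

(** The system and its closed loop with a purified-output-based law.
    Times are relative to the start k of the window. *)

Record lti (R : realType) (nx nu ny nw : nat) := Lti {
  matA : 'M[R]_nx;
  matB : 'M[R]_(nx, nu);
  matC : 'M[R]_(nx, nw);
  matD : 'M[R]_(ny, nx);
  matE : 'M[R]_(ny, nw) }.

Record cost_data (R : realType) (nx nu : nat) := CostData {
  beta : R;
  matQ : 'M[R]_nx;
  matQf : 'M[R]_nx;
  matR : 'M[R]_nu }.

Definition cost_data_ok (R : realType) nx nu (c : cost_data R nx nu) : Prop :=
  [/\ 0 < beta c <= 1, sym_psd (matQ c), sym_psd (matQf c) & sym_pd (matR c)].

Section closed_loop.
Variables (R : realType) (nx nu ny nw N : nat) (sys : lti R nx nu ny nw).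

(* H_N = [h H] *)
Definition law : Type := 'M[R]_(stk N nu, 1 + stk N ny).

Definition lawh (HN : law) : 'cV[R]_(stk N nu) := lsubmx HN.
Definition lawH (HN : law) : 'M[R]_(stk N nu, stk N ny) := rsubmx HN.

Definition causal (HN : law) : Prop :=
  forall t s : 'I_N, (t < s)%N -> submxblock (lawH HN) t s = 0.

Definition gain (HN : law) (t s : nat) : 'M[R]_(nu, ny) :=
  oapp (fun i : 'I_N =>
    oapp (fun j : 'I_N => submxblock (lawH HN) i j) 0 (insub s)) 0 (insub t).

(* State of the closed loop at time t: the state x_t, the nominal state, and
   the purified outputs v_0, ..., v_(t-1) observed so far. *)
Record loop_state := LoopState {
  ls_x : 'cV[R]_nx;
  ls_xhat : 'cV[R]_nx;
  ls_v : seq 'cV[R]_ny }.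

(* v_t = y_t - yhat_t *)
Definition purified (st : loop_state) (w : 'cV[R]_nw) : 'cV[R]_ny :=
  (matD sys *m ls_x st + matE sys *m w) - matD sys *m ls_xhat st.

Definition pob_input (HN : law) (t : nat) (st : loop_state) (w : 'cV[R]_nw)
    : 'cV[R]_nu :=
  let v := rcons (ls_v st) (purified st w) in
  block (lawh HN) t + \sum_(s < t.+1) gain HN t s *m v`_s.

Fixpoint loop (x : 'cV[R]_nx) (HN : law) (xi : 'cV[R]_(stk N nw)) (t : nat)
    : loop_state :=
  if t is t'.+1 then
    let st := loop x HN xi t' in
    let w := block xi t' in
    let u := pob_input HN t' st w in
    LoopState (matA sys *m ls_x st + matB sys *m u + matC sys *m w)
              (matA sys *m ls_xhat st + matB sys *m u)
              (rcons (ls_v st) (purified st w))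
  else LoopState x 0 [::].

Definition state x HN xi t : 'cV[R]_nx := ls_x (loop x HN xi t).

Definition input x HN xi t : 'cV[R]_nu :=
  pob_input HN t (loop x HN xi t) (block xi t).

Definition cost (c : cost_data R nx nu) x HN xi : R :=
  \sum_(t < N) beta c ^+ t * (qform (matQ c) (state x HN xi t)
                              + qform (matR c) (input x HN xi t))
  + beta c ^+ N * qform (matQf c) (state x HN xi N).

(* maximum over 1 <= t <= N; the default value is its first term *)
Definition ell (i : 'I_nx) x HN xi : R :=
  \big[Order.max/state x HN xi 1 i 0]_(1 <= t < N.+1) state x HN xi t i 0.

End closed_loop.

(** Stacked form *)

Section stacked.
Variables (R : realType) (nx nu ny nw N : nat) (sys : lti R nx nu ny nw).
Let A := matA sys.
Let B := matB sys.
Let C := matC sys.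
Let D := matD sys.
Let E := matE sys.

Definition stAx : 'M[R]_(stk N.+1 nx, nx) := \mxcol_(t < N.+1) (A ^+ t).

Definition stBx : 'M[R]_(stk N.+1 nx, stk N nu) :=
  \mxblock_(t < N.+1, s < N)
    (if (s < t)%N then A ^+ (t - s.+1) *m B else 0).

Definition stCx : 'M[R]_(stk N.+1 nx, stk N nw) :=
  \mxblock_(t < N.+1, s < N)
    (if (s < t)%N then A ^+ (t - s.+1) *m C else 0).

Definition stAy : 'M[R]_(stk N ny, nx) := \mxcol_(t < N) (D *m A ^+ t).

Definition stCy : 'M[R]_(stk N ny, stk N nw) :=
  \mxblock_(t < N, s < N)
    (if (s < t)%N then D *m A ^+ (t - s.+1) *m C else 0).

Definition stEy : 'M[R]_(stk N ny, stk N nw) :=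
  \mxblock_(t < N, s < N) (if t == s then E else 0).

Variable x : 'cV[R]_nx.

Definition tildeCx : 'M[R]_(stk N.+1 nx, 1 + stk N nw) :=
  row_mx (stAx *m x) stCx.

Definition tildeCy : 'M[R]_(1 + stk N ny, 1 + stk N nw) :=
  block_mx 0 0 (stAy *m x) stCy.

Definition tildeEy : 'M[R]_(1 + stk N ny, 1 + stk N nw) :=
  block_mx 1%:M 0 0 stEy.

Definition tildeH (HN : law R nu ny N) : 'M[R]_(stk N nu, 1 + stk N nw) :=
  HN *m (tildeCy + tildeEy).

(* x_[k:k+N] = state_map HN *m (1, xi) *)
Definition state_map (HN : law R nu ny N)
    : 'M[R]_(stk N.+1 nx, 1 + stk N nw) :=
  stBx *m tildeH HN + tildeCx.

Variable c : cost_data R nx nu.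

Definition stJx : 'M[R]_(stk N.+1 nx) :=
  \mxdiag_(t < N.+1)
    (if (t < N)%N then beta c ^+ t *: matQ c else beta c ^+ N *: matQf c).

Definition stJu : 'M[R]_(stk N nu) := \mxdiag_(t < N) (beta c ^+ t *: matR c).

Definition stM (HN : law R nu ny N) : 'M[R]_(1 + stk N nw) :=
  (state_map HN)^T *m stJx *m state_map HN + (tildeH HN)^T *m stJu *m tildeH HN.

(* Row of state_map for component i of x_(k+t+1), i.e. the row with (1-based)
   number (t+1) * nx + i; lift ord0 t is t + 1 as an index of the blocks
   0, ..., N. *)
Definition state_row (HN : law R nu ny N) (t : 'I_N) (i : 'I_nx)
    : 'rV[R]_(1 + stk N nw) :=
  row (@tagnat.Rank N.+1 (fun=> nx) (lift ord0 t) i) (state_map HN).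

Definition coefa HN t i : 'cV[R]_(stk N nw) := (rsubmx (state_row HN t i))^T.
Definition coefb HN t i : R := lsubmx (state_row HN t i) 0 0.

End stacked.

(* Mean and covariance of (1, xi), where xi stacks N i.i.d. vectors with mean
   mu and covariance Sigma. *)
Definition ext_mean (R : realType) nw N (mu : 'cV[R]_nw)
    : 'cV[R]_(1 + stk N nw) :=
  col_mx 1%:M (\mxcol_(t < N) mu).

Definition ext_cov (R : realType) nw N (Sigma : 'M[R]_nw)
    : 'M[R]_(1 + stk N nw) :=
  block_mx 0 0 0 (\mxdiag_(t < N) Sigma).

(** Random vectors *)

Section random_vectors.
Local Open Scope ereal_scope.
Variables (R : realType) (d : measure_display) (Om : measurableType d).
Variables (P : probability Om R) (n : nat).

Definition iid (I : choiceType) (w : I -> Om -> borelV R n) : Prop :=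
  [/\ forall t, measurable_fun setT (w t),
      forall (J : seq I) (F : I -> set (borelV R n)), uniq J ->
        (forall t, measurable (F t)) ->
        P (\bigcap_(t in [set` J]) (w t @^-1` F t))
        = \prod_(t <- J) P (w t @^-1` F t) &
      forall t s (F : set (borelV R n)), measurable F ->
        P (w t @^-1` F) = P (w s @^-1` F)].

Definition has_mean_cov (X : Om -> 'cV[R]_n) (mu : 'cV[R]_n) (Sigma : 'M[R]_n)
    : Prop :=
  let comp i := fun om => (X om i 0)%R : R in
  [/\ forall i, comp i \in Lfun P 2%:E,
      forall i, 'E_P[comp i] = (mu i 0)%:E &
      forall i j, covariance P (comp i) (comp j) = (Sigma i j)%:E].

End random_vectors.

(** Wasserstein ambiguity sets *)

Section ambiguity.
Local Open Scope ereal_scope.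
Variables (R : realType) (n : nat) (nrm : 'cV[R]_n -> R) (Xi : set 'cV[R]_n).
Local Notation T := (borelV R n).

(* the set M(Xi) *)
Definition supported : set (probability T R) :=
  [set Q : probability T R | Q Xi = 1 /\ \int[Q]_(xi in Xi) (nrm xi)%:E < +oo].

Definition light_tailed (alpha : R) : set (probability T R) :=
  [set Q : probability T R | \int[Q]_(xi in Xi) (expR (nrm xi `^ alpha))%:E < +oo].

Definition coupling (Q1 Q2 : set T -> \bar R) : set (probability (T * T)%type R) :=
  [set Pi : probability (T * T)%type R | forall S : set T, measurable S ->
     Pi (fst @^-1` S) = Q1 S /\ Pi (snd @^-1` S) = Q2 S].

Definition wasserstein (Q1 Q2 : set T -> \bar R) : \bar R :=
  ereal_inf [set \int[Pi]_(z in Xi `*` Xi) (nrm ((z.1 : 'cV[R]_n) - z.2))%:E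
            | Pi in coupling Q1 Q2].

Definition empirical Ns (sample : 'I_Ns -> 'cV[R]_n) (S : set T) : \bar R :=
  (Ns%:R^-1)%:E * \sum_(i < Ns) \d_(sample i : T) S.

Definition wball (alpha eps : R) Ns (sample : 'I_Ns -> 'cV[R]_n)
    : set (probability T R) :=
  [set Q : probability T R | [/\ supported Q, light_tailed alpha Q &
               wasserstein (empirical sample) Q <= eps%:E]].

End ambiguity.

(* Laws of xi = (w_0, ..., w_(N-1)) under which the w_t are i.i.d. with mean mu
   and covariance Sigma. *)
Definition iid_laws (R : realType) nw N (mu : 'cV[R]_nw) (Sigma : 'M[R]_nw)
    : set (probability (borelV R (stk N nw)) R) :=
  [set Q : probability (borelV R (stk N nw)) R | iid Q (fun (t : 'I_N) (xi : borelV R (stk N nw)) =>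
                    submxcol (xi : 'cV[R]_(stk N nw)) t : borelV R nw)
    /\ forall t : 'I_N,
         has_mean_cov Q (fun xi => submxcol (xi : 'cV[R]_(stk N nw)) t) mu Sigma].

(** The distributionally robust control problem *)

Section robust_problem.
Local Open Scope ereal_scope.
Variables (R : realType) (nx nu ny nw N : nat).
Variables (sys : lti R nx nu ny nw) (x : 'cV[R]_nx).

Definition dr_cost (c : cost_data R nx nu)
    (amb : set (probability (borelV R (stk N nw)) R)) (HN : law R nu ny N)
    : \bar R :=
  ereal_sup [set 'E_Q[cost sys c x HN] | Q in amb].

Definition dr_feasible (amb : set (probability (borelV R (stk N nw)) R))
    Nb (m : 'I_Nb -> 'I_nx) (U : 'I_Nb -> R) : set (law R nu ny N) :=
  [set HN | causal HN /\
    forall j, ereal_sup [set 'E_Q[ell sys (m j) x HN] | Q in amb] <= (U j)%:E].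

End robust_problem.

(** The convex program *)

Section program.
Variables (R : realType) (nx nu ny nw N Nb Ns q : nat).
Variables (sys : lti R nx nu ny nw) (x : 'cV[R]_nx).

(* variables (H_N, lambda, s, gamma); the index t : 'I_N of gamma stands for
   the time t + 1 *)
Definition cp_var :=
  (law R nu ny N * 'rV[R]_Nb * 'M[R]_(Ns, Nb)
   * {ffun 'I_Ns * 'I_Nb * 'I_N -> 'cV[R]_q})%type.

Definition cp_cost (c : cost_data R nx nu) (mu : 'cV[R]_nw) (Sigma : 'M[R]_nw)
    (HN : law R nu ny N) : R :=
  \tr (stM sys x c HN *m ext_cov N Sigma)
  + qform (stM sys x c HN) (ext_mean N mu).

Definition cp_feasible (nrm : 'cV[R]_(stk N nw) -> R)
    (Cxi : 'M[R]_(q, stk N nw)) (dxi : 'cV[R]_q) (eps : R)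
    (sample : 'I_Ns -> 'cV[R]_(stk N nw)) (m : 'I_Nb -> 'I_nx)
    (U : 'I_Nb -> R) : set cp_var :=
  [set z : cp_var | let: (HN, lambda, s, gamma) := z in
    [/\ causal HN,
        forall j, lambda 0 j * eps + Ns%:R^-1 * \sum_i s i j <= U j &
        forall i j t,
          let a := coefa sys x HN t (m j) in
          let b := coefb sys x HN t (m j) in
          let g := gamma (i, j, t) in
          [/\ b + dotv a (sample i) + dotv g (dxi - Cxi *m sample i) <= s i j,
              dual_norm nrm (Cxi^T *m g - a) <= lambda 0 j &
              forall l, 0 <= g l 0]]].

End program.

(* Main.v *)
(** Each constraint function [ell_j] is a maximum of finitely many affine
functions [b_t + <a_t, xi>] of the disturbance sequence, and the stage cost is a
quadratic form in [(1, xi)].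

Duality.  The conditions on [(lambda, s, z)], with [z_it] in the dual ball of
radius [lambda], which say that [lambda eps + mean s <= U] and that
[b_t + <a_t, xi> - <z_it, xi - xihat_i> <= s_i] on [Xi], form an infinite system
of linear inequalities, finitely many of which already bound all the unknowns.
By compactness and
Farkas' lemma the system is either solvable or refuted by finitely many nonnegative
multipliers.  In the second case the multipliers of the inequalities indexed by
[(i, t, xi)], averaged over [xi], move the mass of the sample [xihat_i] to points
of [Xi] at total transport cost at most [eps], and this finitely supported law
violates the constraint.  In the first case a second use of Farkas'
lemma on the polytope turns [z_it] into the multiplier [gamma_it].  The converse is
weak duality, integrated against a nearly optimal coupling.

Objective.  Every law of the ambiguity set that makes the [w_t] i.i.d. gives the
quadratic cost the same expectation, as it only depends on the first two moments;
the given law of the window is one of them.  The same formula transports the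
pointwise convexity in [H_N] of the quadratic form to the objective. *)
From HB Require Import structures.
Require Import Defs.
From mathcomp Require Import all_boot all_order all_algebra finmap.
From mathcomp Require Import all_classical all_reals all_analysis.
From mathcomp Require Import measurable_realfun.
From mathcomp Require Import ring lra.

Set Implicit Arguments.
Unset Strict Implicit.
Unset Printing Implicit Defensive.

Import Order.TTheory GRing.Theory Num.Theory.
Import numFieldNormedType.Exports.

Local Open Scope classical_set_scope.
Local Open Scope ring_scope.

(** * Farkas' lemma *)

Lemma scalar_form0 (F : pzRingType) (V : lmodType F) (f : V -> F) :
  scalar f -> f 0 = 0.
Proof. by move=> /(_ (-1) 0 0); rewrite scaler0 addr0 mulN1r addNr. Qed.

Lemma scalar_formZ (F : pzRingType) (V : lmodType F) (f : V -> F) k v :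
  scalar f -> f (k *: v) = k * f v.
Proof. by move=> fs; have := fs k v 0; rewrite !addr0 (scalar_form0 fs) addr0. Qed.

Lemma scalar_formD (F : pzRingType) (V : lmodType F) (f : V -> F) u v :
  scalar f -> f (u + v) = f u + f v.
Proof. by move=> fs; have := fs 1 u v; rewrite scale1r mul1r. Qed.

(* Bartl's induction: a functional [x] separating [b] from the cone of the
   first forms but violating the new form [a i] is used to project along [x]
   onto the kernel of [a i]. *)
Lemma farkas_seq (F : realFieldType) (V : lmodType F) (I : eqType)
    (s : seq I) (a : I -> V -> F) (b : V -> F) :
  uniq s -> (forall i, scalar (a i)) -> scalar b ->
  (exists2 y : I -> F, forall i, 0 <= y i &
     forall v, b v = \sum_(i <- s) y i * a i v) \/
  (exists2 v, forall i, i \in s -> a i v <= 0 & 0 < b v).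
Proof.
elim: s a b => [|i s IH] a b /=.
  move=> _ _ bs; have [[v bv]|nb] := pselect (exists v, 0 < b v).
    by right; exists v.
  left; exists (fun=> 0) => // v; rewrite big_nil.
  apply/eqP; rewrite eq_le; apply/andP; split.
    by rewrite leNgt; apply/negP => bv; apply: nb; exists v.
  rewrite leNgt; apply/negP => bv; apply: nb; exists (- v).
  by rewrite -scaleN1r scalar_formZ// mulN1r oppr_gt0.
move=> /andP[ins us] as_ bs.
have [[y y0 yE]|[x xs bx]] := IH a b us as_ bs.
  left; exists (fun j => if j == i then 0 else y j) => [j|v]; first by case: ifP.
  rewrite big_cons eqxx mul0r add0r yE; apply: eq_big_seq => j js.
  by case: eqVneq => // ji; rewrite -ji js in ins.
have [aix|aix] := leP (a i x) 0.
  by right; exists x => // j; rewrite inE => /orP[/eqP->|/xs].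
(* Scaling to [a i u = 1] makes [v - a i v *: u] the projection along [u] onto the kernel of [a i];
   [proj] composes forms with it. *)
pose u := (a i x)^-1 *: x.
have aiu : a i u = 1 by rewrite scalar_formZ// mulVf// gt_eqF.
have au j : j \in s -> a j u <= 0.
  by move=> js; rewrite scalar_formZ// mulr_ge0_le0 ?xs// invr_ge0 ltW.
have bu : 0 < b u by rewrite scalar_formZ// mulr_gt0// invr_gt0.
have proj (g : V -> F) : scalar g -> scalar (fun v => g v - g u * a i v).
  by move=> gs k v w /=; rewrite gs as_ mulrBr mulrDr opprD addrACA mulrCA.
have [|[y y0 yE]|[v vs bv]] := IH (fun j v => a j v - a j u * a i v)
    (fun v => b v - b u * a i v) us _ (proj _ bs).
- by move=> j; exact: proj.
(* Expanding the projected forms leaves this coefficient on [a i]. It is nonnegative because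
   [b u > 0] while every [a k u <= 0]. *)
- left; exists (fun j => if j == i then b u - \sum_(k <- s) y k * a k u else y j).
    move=> j; case: ifP => // _; rewrite subr_ge0 (le_trans _ (ltW bu))//.
    rewrite -oppr_ge0 -sumrN big_seq sumr_ge0// => k ks.
    by rewrite -mulrN mulr_ge0// oppr_ge0 au.
  move=> v; rewrite big_cons eqxx.
  have := yE v; rewrite (eq_bigr (fun k => y k * a k v - y k * a k u * a i v));
    last by move=> k _; rewrite mulrBr mulrA.
  rewrite sumrB -mulr_suml => bE; rewrite -[b v](subrK (b u * a i v)) bE.
  rewrite [X in _ = _ + X](_ : _ = \sum_(k <- s) y k * a k v); first by ring.
  by apply: eq_big_seq => j js; case: eqVneq => // ji; rewrite -ji js in ins.
- right; exists (v - a i v *: u) => [j|].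
    have aE g : scalar g -> g (v - a i v *: u) = g v - g u * a i v.
      by move=> gs; rewrite [X in g X]addrC -scaleNr gs mulNr addrC [_ * g u]mulrC.
    rewrite aE// inE => /orP[/eqP ->|/vs//].
    by rewrite aiu mul1r subrr.
  by rewrite [X in b X]addrC -scaleNr bs mulNr addrC [_ * b u]mulrC.
Qed.

Lemma farkas (F : realFieldType) (V : lmodType F) (I : finType)
    (a : I -> V -> F) (b : V -> F) :
  (forall i, scalar (a i)) -> scalar b ->
  (exists2 y : I -> F, forall i, 0 <= y i &
     forall v, b v = \sum_i y i * a i v) \/
  (exists2 v, forall i, a i v <= 0 & 0 < b v).
Proof.
move=> as_ bs.
have [[y y0 yE]|[v va vb]] := farkas_seq (index_enum_uniq I) as_ bs.
  by left; exists y.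
by right; exists v => // i; rewrite va// mem_index_enum.
Qed.

(** Homogenise with an extra coordinate [t]: the forms [a i v - beta i * t] are tested against [t].
    A separating vector has [t > 0] and is rescaled to a solution; otherwise the multipliers satisfy
    [\sum y i * beta i = -1]. *)
Lemma farkas_infeasible (F : realFieldType) (V : lmodType F) (I : eqType)
    (s : seq I) (a : I -> V -> F) (beta : I -> F) :
  uniq s -> (forall i, scalar (a i)) ->
  (exists v, forall i, i \in s -> a i v <= beta i) \/
  (exists y : I -> F, [/\ forall i, 0 <= y i,
     forall v, \sum_(i <- s) y i * a i v = 0 & \sum_(i <- s) y i * beta i < 0]).
Proof.
move=> us as_.
pose a' i (v : (V * F^o)%type) := a i v.1 - beta i * v.2.
have a's i : scalar (a' i).
  by move=> k u v; rewrite /a' /= as_ mulrBr mulrDr opprD addrACA mulrCA.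
have [|[y y0 yE]|[[v t] /= va t0]] :=
    farkas_seq (a := a') (b := fun v => v.2) us a's.
- by move=> k u v.
- right; exists y; split=> // [v|].
    have := yE (v, 0) => /= /esym; rewrite /a' /= => sE.
    by rewrite -[RHS]sE; apply: eq_bigr => i _; rewrite mulr0 subr0.
  have := yE (0, 1) => /= /esym sE; rewrite -oppr_gt0 -sumrN.
  rewrite (eq_bigr (fun i => y i * a' i (0, 1))) ?sE// => i _.
  by rewrite /a'/= scalar_form0// sub0r mulr1 mulrN.
- left; exists (t^-1 *: v) => i /va; rewrite /a'/= subr_le0 scalar_formZ// => le.
  by rewrite mulrC ler_pdivrMr.
Qed.

(** The affine form of the lemma, again by homogenisation, now with the additional inequality
    [- t <= 0]. Its multiplier is the slack between [\sum y i * beta i] and [sigma]. *)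
Lemma farkas_consequence (F : realFieldType) (V : lmodType F) (I : finType)
    (a : I -> V -> F) (beta : I -> F) (b : V -> F) (sigma : F) (v0 : V) :
  (forall i, scalar (a i)) -> scalar b -> (forall i, a i v0 <= beta i) ->
  (forall v, (forall i, a i v <= beta i) -> b v <= sigma) ->
  exists y : I -> F, [/\ forall i, 0 <= y i,
    forall v, b v = \sum_i y i * a i v & \sum_i y i * beta i <= sigma].
Proof.
move=> as_ bs av0 bv.
pose a' (i : option I) (v : (V * F^o)%type) :=
  if i is Some i then a i v.1 - beta i * v.2 else - v.2.
have a's i : scalar (a' i).
  case: i => [i|] k u v; last by rewrite /a' /= opprD mulrN.
  by rewrite /a' /= as_ mulrBr mulrDr opprD addrACA mulrCA.
have [|[y y0 yE]|[[v t] /= va t0]] :=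
    farkas (a := a') (b := fun v => b v.1 - sigma * v.2) a's.
- by move=> k u v /=; rewrite bs mulrBr mulrDr opprD addrACA mulrCA.
- have sumE (f : option I -> F) : \sum_i f i = f None + \sum_i f (Some i).
    by rewrite (bigD1 None)//=; congr (_ + _); rewrite (reindex_omap Some id)//=;
      [apply: eq_bigl => i; rewrite eqxx | case].
  exists (y \o Some); split=> [i|v|/=]; first exact: y0.
    have := yE (v, 0) => /=; rewrite mulr0 subr0 => ->.
    rewrite sumE /a' /= oppr0 mulr0 add0r; apply: eq_bigr => i _.
    by rewrite mulr0 subr0.
  have := yE (0, 1) => /=; rewrite (scalar_form0 bs) sumE /a'/= mulrN !mulr1 sub0r.
  under eq_bigr do rewrite scalar_form0// mulr1 sub0r mulrN.
  rewrite sumrN -opprD => /oppr_inj ->; rewrite lerDr; exact: y0.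
- have t_ge0 : 0 <= t by have := va None; rewrite /a' /= oppr_le0.
  have av i : a i v <= beta i * t by have := va (Some i); rewrite /a' /= subr_le0.
  have [t00|tn0] := eqVneq t 0.
    rewrite t00 mulr0 subr0 in t0.
    (* With [t = 0], [v] is a recession direction along which [b] grows; [k] is large enough for
       [b (k *: v + v0)] to exceed [sigma], although this point satisfies all the constraints. *)
    pose k := Num.max 0 ((sigma - b v0) / b v + 1).
    have k0 : 0 <= k by rewrite le_max lexx.
    have := bv (k *: v + v0); rewrite bs; apply: contraPP => _.
    move=> /(_ _)/wrap[i|].
      rewrite as_ -[leRHS]add0r lerD// mulr_ge0_le0//.
      by rewrite (le_trans (av i))// t00 mulr0.
    apply/negP; rewrite -ltNge -ltrBlDr -ltr_pdivrMr// lt_max ltrDl ltr01.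
    by rewrite orbT.
  have tp : 0 < t by rewrite lt_def tn0.
  have := bv (t^-1 *: v); rewrite scalar_formZ// mulrC ler_pdivrMr//; apply: contraPP => _.
  move=> /(_ _)/wrap[i|]; first by rewrite scalar_formZ// mulrC ler_pdivrMr.
  by apply/negP; rewrite -ltNge -subr_gt0.
Qed.

(** * Continuity on matrix spaces and Farkas' lemma for infinite systems *)

Lemma coord_le_mx_norm (R : realType) m n (A : 'M[R]_(m, n)) i j :
  `|A i j| <= `|A|.
Proof.
rewrite [leRHS]/Num.norm /= mx_normrE.
exact: (@le_bigmax_cond _ _ _ 0 (i, j) xpredT (fun ij => `|A ij.1 ij.2|)).
Qed.

(** Expanding [x] in matrix units, the sum of the values of [p] on these units serves as the
    constant. *)
Lemma subadditive_le_mx_norm (R : realType) m n (p : 'M[R]_(m, n) -> R) :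
  (forall x y, p (x + y) <= p x + p y) ->
  (forall c x, p (c *: x) = `|c| * p x) ->
  exists L, forall x, p x <= L * `|x|.
Proof.
move=> pD pZ.
have p0 : p 0 = 0 by rewrite -(scale0r 0) pZ normr0 mul0r.
have p_ge0 x : 0 <= p x.
  have := pD x (- x); rewrite subrr p0 -scaleN1r pZ normrN1 mul1r.
  by rewrite -mulr2n pmulrn_lge0.
have p_sum (I : finType) (F : I -> 'M[R]_(m, n)) :
    p (\sum_i F i) <= \sum_i p (F i).
  elim/big_ind2 : _ => [|x1 x2 y1 y2 h1 h2|//]; first by rewrite p0.
  by rewrite (le_trans (pD _ _))// lerD.
exists (\sum_i \sum_j p (delta_mx i j)) => x.
rewrite {1}(matrix_sum_delta x) (le_trans (p_sum _ _))// mulr_suml ler_sum// => i _.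
rewrite (le_trans (p_sum _ _))// mulr_suml ler_sum// => j _.
by rewrite pZ mulrC ler_wpM2l// coord_le_mx_norm.
Qed.

Lemma lipschitz_continuous_mx (R : realType) m n (f : 'M[R]_(m, n) -> R) L :
  (forall x y, f x - f y <= L * `|x - y|) -> continuous f.
Proof.
move=> fL x A /= /nbhs_ballP [e /= e0 eA].
(* The sign of [L] is not known, hence the positive constant [|L| + 1] in its place. *)
have L0 : 0 < `|L| + 1 by rewrite ltr_wpDl.
apply/nbhs_ballP; exists (e / (`|L| + 1)) => /= [|y]; first by rewrite divr_gt0.
rewrite mx_norm_ball /ball_/= => xy; apply: eA.
have Le (z : 'M[R]_(m, n)) : L * `|z| <= (`|L| + 1) * `|z|.
  by rewrite ler_wpM2r// (le_trans (ler_norm _))// lerDl.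
have lt_e (z : 'M[R]_(m, n)) : `|z| < e / (`|L| + 1) -> L * `|z| < e.
  by move=> ze; rewrite (le_lt_trans (Le z))// mulrC -ltr_pdivlMr.
rewrite -ball_normE /ball_ /=; apply/ltr_normlP; split.
  by rewrite opprB (le_lt_trans (fL _ _))// lt_e// distrC.
by rewrite (le_lt_trans (fL _ _))// lt_e.
Qed.

Lemma scalar_continuous (R : realType) m n (f : 'M[R]_(m, n) -> R) :
  scalar f -> continuous f.
Proof.
move=> fs.
have [L fL] : exists L, forall x, `|f x| <= L * `|x|.
  apply: subadditive_le_mx_norm => [x y|c x].
    by rewrite (scalar_formD _ _ fs)// ler_normD.
  by rewrite (scalar_formZ _ _ fs)// normrM.
apply: (@lipschitz_continuous_mx _ _ _ _ L) => x y.
rewrite (le_trans _ (fL _))// (le_trans _ (ler_norm _))//.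
by rewrite (scalar_formD _ _ fs) -[- y]scaleN1r (scalar_formZ _ _ fs) mulN1r.
Qed.

(** The inequalities of [J0] confine solutions to a compact box. Without a finite certificate every
    finite subsystem is solvable, so the closed half-spaces have the finite intersection property
    inside that box. *)
Lemma farkas_compact (R : realType) n (J : choiceType) (D : set J)
    (a : J -> 'rV[R]_n -> R) (beta : J -> R) (J0 : seq J) :
  (forall j, scalar (a j)) -> (forall j, j \in J0 -> D j) ->
  (forall k, exists M, forall v, (forall j, j \in J0 -> a j v <= beta j) ->
     `|v 0 k| <= M) ->
  (exists v, forall j, D j -> a j v <= beta j) \/
  (exists s : seq J, [/\ uniq s, forall j, j \in s -> D j &
     exists y : J -> R, [/\ forall j, 0 <= y j,
       forall v, \sum_(j <- s) y j * a j v = 0 &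
       \sum_(j <- s) y j * beta j < 0]]).
Proof.
move=> as_ J0D bnd.
have [|nocert] := pselect (exists s : seq J, [/\ uniq s,
     forall j, j \in s -> D j & exists y : J -> R, [/\ forall j, 0 <= y j,
       forall v, \sum_(j <- s) y j * a j v = 0 &
       \sum_(j <- s) y j * beta j < 0]]); first by right.
left.
have feas (s : {fset J}) : (forall j, j \in s -> D j) ->
    exists v, forall j, j \in s -> a j v <= beta j.
  move=> sD; have [//|//|] := farkas_infeasible (s := enum_fset s) beta _ as_.
  by move=> cert; exfalso; apply: nocert; exists (enum_fset s).
pose half j := [set v | a j v <= beta j].
have halfC j : closed (half j).
  apply: (@preimage_closed _ _ (a j) [set x | x <= beta j]); last exact: closed_le.
  by move=> v _; exact: scalar_continuous.
have [M MP] := choice bnd.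
pose A := \bigcap_(j in [set` J0]) half j.
have cA : compact A.
  apply: (subclosed_compact (B := [set v : 'rV[R]_n |
      forall k, `[- M k, M k]%classic (v ord0 k)])).
  - exact: closed_bigI.
  - apply: (@rV_compact _ _ (fun k => `[- M k, M k]%classic)) => k.
    exact: segment_compact.
  - by move=> v Av k; rewrite /= in_itv/= -ler_norml; exact: MP.
have : \bigcap_(j in D) (A `&` half j) !=set0.
  rewrite compact_In0 in cA; apply: cA.
    by exists half.
  (* Solving [E] together with [J0] puts the solution in the compact set [A]. *)
  move=> E ED; have [|v vP] := feas ([fset j in J0] `|` E)%fset.
    by move=> j; rewrite !inE => /orP[/J0D//|/ED]; rewrite inE.
  exists v => j /= jE; split; first by move=> j0 /= jJ; apply: vP; rewrite !inE jJ.
  by apply: vP; rewrite !inE jE orbT.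
by move=> [v vP]; exists v => j /vP[].
Qed.

(** * Norms, inner products and dual norms *)

Section norms.
Context {R : realType} {n : nat}.
Variable nrm : 'cV[R]_n -> R.
Hypothesis nrmP : is_norm nrm.

Lemma is_normD x y : nrm (x + y) <= nrm x + nrm y.
Proof. by case: nrmP. Qed.

Lemma is_normZ c x : nrm (c *: x) = `|c| * nrm x.
Proof. by case: nrmP. Qed.

Lemma is_norm0 : nrm 0 = 0.
Proof. by rewrite -(scale0r 0) is_normZ normr0 mul0r. Qed.

Lemma is_normN x : nrm (- x) = nrm x.
Proof. by rewrite -scaleN1r is_normZ normrN1 mul1r. Qed.

Lemma is_norm_ge0 x : 0 <= nrm x.
Proof.
by have := is_normD x (- x); rewrite subrr is_norm0 is_normN -mulr2n pmulrn_lge0.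
Qed.

Lemma is_norm_gt0 x : x != 0 -> 0 < nrm x.
Proof.
rewrite lt_def is_norm_ge0 andbT; apply: contra_neq.
by case: nrmP => _ _; exact.
Qed.

Lemma is_norm_le_mx_norm : exists L, forall x, nrm x <= L * `|x|.
Proof. exact: subadditive_le_mx_norm is_normD is_normZ. Qed.

Lemma is_norm_continuous : continuous nrm.
Proof.
have [L nL] := is_norm_le_mx_norm.
apply: (@lipschitz_continuous_mx _ _ _ _ L) => x y.
by rewrite (le_trans _ (nL _))// lerBlDr -{1}(subrK y x) is_normD.
Qed.

(** The minimum of [nrm] over the compact unit sphere is attained, hence positive; its inverse is
    the constant. Transposition passes to row vectors, where the extreme value theorem is
    applied. *)
Lemma mx_norm_le_is_norm : exists L, forall x, `|x| <= L * nrm x.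
Proof.
pose S := [set v : 'rV[R]_n | `|v| = 1].
pose g (v : 'rV[R]_n) := nrm v^T.
have normT p q (v : 'M[R]_(p, q)) : `|v^T| = `|v|.
  have le p' q' (w : 'M[R]_(p', q')) : `|w^T| <= `|w|.
    rewrite [leLHS]/Num.norm /= mx_normrE; apply/bigmax_leP; split=> // -[i j] _.
    by rewrite mxE coord_le_mx_norm.
  by apply/eqP; rewrite eq_le le/= -{1}(trmxK v) le.
(* If the sphere is empty, every vector is zero and the constant 0 works. *)
have [[v0 Sv0]|S0] := pselect (S !=set0); last first.
  exists 0 => x; rewrite mul0r.
  have [->|x0] := eqVneq x 0; first by rewrite normr0.
  exfalso; apply: S0; exists (`|x|^-1 *: x)^T; rewrite /S /= normT normrZ.
  by rewrite normfV normr_id mulVf// normr_eq0.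
have [c cS cmin] : exists2 c, c \in S & forall t, t \in S -> g c <= g t.
  apply: EVT_min_rV; first by exists v0.
    apply: bounded_closed_compact.
      by exists 1; split=> // x x1 y /= ->; exact: ltW.
    apply: (@preimage_closed _ _ (fun v : 'rV[R]_n => `|v|) [set x | x = 1]).
      by move=> v _; exact: norm_continuous.
    exact: closed_eq.
  apply: continuous_subspaceT; have [L nL] := is_norm_le_mx_norm.
  apply: (@lipschitz_continuous_mx _ _ _ _ L) => x y.
  rewrite -normT linearB (le_trans _ (nL _))// lerBlDr.
  by rewrite /g -{1}(subrK y^T x^T) is_normD.
have gc0 : 0 < g c.
  apply: is_norm_gt0; apply: contraPneq (set_mem cS) => c0.
  rewrite /S /= -(trmxK c) c0 trmx0 normr0 => /eqP.
  by rewrite eq_sym oner_eq0.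
exists (g c)^-1 => x; have [->|x0] := eqVneq x 0.
  by rewrite normr0 is_norm0 mulr0.
have xp : 0 < `|x| by rewrite normr_gt0.
have := cmin (`|x|^-1 *: x)^T; rewrite /g trmxK is_normZ normfV normr_id.
move=> /(_ _)/wrap[|].
  by rewrite inE /S /= normT normrZ normfV normr_id mulVf// normr_eq0.
by rewrite ler_pdivlMl// => h; rewrite ler_pdivlMl// mulrC.
Qed.

Lemma dotvE (a b : 'cV[R]_n) : dotv a b = \sum_k a k 0 * b k 0.
Proof. by rewrite /dotv mxE; apply: eq_bigr => k _; rewrite mxE. Qed.

Lemma dotvC (a b : 'cV[R]_n) : dotv a b = dotv b a.
Proof. by rewrite !dotvE; apply: eq_bigr => k _; rewrite mulrC. Qed.

Lemma dotvP (c : R) (a b d : 'cV[R]_n) :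
  dotv a (c *: b + d) = c * dotv a b + dotv a d.
Proof. by rewrite /dotv mulmxDr -scalemxAr mxE mxE. Qed.

Lemma dotv0r (a : 'cV[R]_n) : dotv a 0 = 0.
Proof. exact: scalar_form0 (fun c b d => dotvP c a b d). Qed.

Lemma dotvDr (a b c : 'cV[R]_n) : dotv a (b + c) = dotv a b + dotv a c.
Proof. exact: scalar_formD (fun c b d => dotvP c a b d). Qed.

Lemma dotvZr c (a b : 'cV[R]_n) : dotv a (c *: b) = c * dotv a b.
Proof. exact: scalar_formZ (fun c b d => dotvP c a b d). Qed.

Lemma dotvNr (a b : 'cV[R]_n) : dotv a (- b) = - dotv a b.
Proof. by rewrite -scaleN1r dotvZr mulN1r. Qed.

Lemma dotvBr (a b c : 'cV[R]_n) : dotv a (b - c) = dotv a b - dotv a c.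
Proof. by rewrite dotvDr dotvNr. Qed.

Lemma dotvDl (a b c : 'cV[R]_n) : dotv (b + c) a = dotv b a + dotv c a.
Proof. by rewrite ![dotv _ a]dotvC dotvDr. Qed.

Lemma dotvZl c (a b : 'cV[R]_n) : dotv (c *: b) a = c * dotv b a.
Proof. by rewrite ![dotv _ a]dotvC dotvZr. Qed.

Lemma dotvNl (a b : 'cV[R]_n) : dotv (- b) a = - dotv b a.
Proof. by rewrite ![dotv _ a]dotvC dotvNr. Qed.

Lemma dotvBl (a b c : 'cV[R]_n) : dotv (b - c) a = dotv b a - dotv c a.
Proof. by rewrite dotvDl dotvNl. Qed.

Lemma dotv_le_mx_norm (z : 'cV[R]_n) :
  exists L, forall x, `|dotv z x| <= L * `|x|.
Proof.
apply: subadditive_le_mx_norm => [x y|c x]; first by rewrite dotvDr ler_normD.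
by rewrite dotvZr normrM.
Qed.

Lemma dotv_le_norm (z : 'cV[R]_n) :
  exists2 L, 0 <= L & forall x, `|dotv z x| <= L * nrm x.
Proof.
have [L1 L1P] := dotv_le_mx_norm z; have [L2 L2P] := mx_norm_le_is_norm.
exists (`|L1| * `|L2|) => [|x]; first exact: mulr_ge0.
rewrite (le_trans (L1P x))// (@le_trans _ _ (`|L1| * `|x|))//.
  by rewrite ler_wpM2r// ler_norm.
rewrite -mulrA ler_wpM2l// (le_trans (L2P x))// ler_wpM2r ?ler_norm//.
exact: is_norm_ge0.
Qed.

(** This makes [dual_norm] a genuine supremum rather than the default value of [sup]. *)
Lemma dual_norm_has_sup (z : 'cV[R]_n) :
  has_sup [set dotv z x | x in [set x | nrm x <= 1]].
Proof.
have [L L0 LP] := dotv_le_norm z.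
split; first by exists 0, 0; rewrite /= ?is_norm0 ?dotv0r.
exists L => _ [x /= x1 <-]; rewrite (le_trans (ler_norm _))// (le_trans (LP x))//.
by rewrite ler_piMr.
Qed.

Lemma dotv_le_dual_norm (z x : 'cV[R]_n) : dotv z x <= dual_norm nrm z * nrm x.
Proof.
have [->|x0] := eqVneq x 0; first by rewrite dotv0r is_norm0 mulr0.
have nx0 := is_norm_gt0 x0.
rewrite -ler_pdivrMr// mulrC -dotvZr; apply: ub_le_sup.
  by case: (dual_norm_has_sup z).
exists ((nrm x)^-1 *: x) => //=.
by rewrite is_normZ normfV (ger0_norm (ltW nx0)) mulVf// gt_eqF.
Qed.

Lemma dual_norm_leP (z : 'cV[R]_n) (lambda : R) :
  dual_norm nrm z <= lambda <-> (forall x, nrm x <= 1 -> dotv z x <= lambda).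
Proof.
split=> [zl x x1|zl].
  rewrite (le_trans _ zl)//; apply: ub_le_sup; last by exists x.
  by case: (dual_norm_has_sup z).
apply: ge_sup; first by case: (dual_norm_has_sup z).
by move=> _ [x /= x1 <-]; exact: zl.
Qed.

Lemma dual_norm_ge0 (z : 'cV[R]_n) : 0 <= dual_norm nrm z.
Proof.
rewrite -[leLHS](dotv0r z); have /dual_norm_leP := lexx (dual_norm nrm z).
by apply; rewrite is_norm0.
Qed.

Lemma dual_normD (y z : 'cV[R]_n) :
  dual_norm nrm (y + z) <= dual_norm nrm y + dual_norm nrm z.
Proof.
apply/dual_norm_leP => x x1; rewrite dotvDl lerD//.
  by have /dual_norm_leP := lexx (dual_norm nrm y); exact.
by have /dual_norm_leP := lexx (dual_norm nrm z); exact.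
Qed.

Lemma dual_normZ c (z : 'cV[R]_n) : 0 <= c ->
  dual_norm nrm (c *: z) <= c * dual_norm nrm z.
Proof.
move=> c0; apply/dual_norm_leP => x x1; rewrite dotvZl ler_wpM2l//.
by have /dual_norm_leP := lexx (dual_norm nrm z); exact.
Qed.

End norms.

(** * The finite-dimensional alternative *)

(** Convexity of the polytope, for weights of positive but arbitrary total: Farkas multipliers come
    unnormalised. *)
Lemma polytope_barycenter (R : realType) n q (C : 'M[R]_(q, n)) d (I : eqType)
    (s : seq I) (P : pred I) (p : I -> R) (f : I -> 'cV[R]_n) :
  (forall i, 0 <= p i) -> (forall i, i \in s -> P i -> polytope C d (f i)) ->
  0 < \sum_(i <- s | P i) p i ->
  polytope C d ((\sum_(i <- s | P i) p i)^-1 *: \sum_(i <- s | P i) p i *: f i).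
Proof.
move=> p0 fP sp k; rewrite -scalemxAr mulmx_sumr mxE summxE ler_pdivrMl//.
rewrite mulr_suml big_seq_cond [leRHS]big_seq_cond ler_sum// => i /andP[si Pi].
by rewrite -scalemxAr mxE ler_wpM2l//; exact: fP.
Qed.

Lemma dotv_inj (R : realType) n (x y : 'cV[R]_n) :
  (forall w, dotv w x = dotv w y) -> x = y.
Proof.
move=> xy; apply/colP => k.
have := xy (delta_mx k 0); rewrite !dotvE (bigD1 k)//= [RHS](bigD1 k)//=.
rewrite !big1 ?mxE ?eqxx ?mul1r ?addr0// => j jk;
  by rewrite mxE (negbTE jk) mul0r.
Qed.

Section sum_sumType.
Variables (A B C : Type).

Definition pick1 (j : A + B + C) := if j is inl (inl x) then Some x else None.
Definition pick2 (j : A + B + C) := if j is inl (inr x) then Some x else None.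
Definition pick3 (j : A + B + C) := if j is inr x then Some x else None.

(** Separates a certificate into the multipliers of the three families of inequalities. *)
Lemma sum_pick (V : nmodType) (s : seq (A + B + C)) (f : A + B + C -> V) :
  \sum_(j <- s) f j = \sum_(x <- pmap pick1 s) f (inl (inl x))
    + \sum_(x <- pmap pick2 s) f (inl (inr x)) + \sum_(x <- pmap pick3 s) f (inr x).
Proof.
elim: s => [|[[x|x]|x] s IH] /=; rewrite ?big_nil ?addr0// !big_cons IH.
- by rewrite !addrA.
- by rewrite addrA addrCA.
- by rewrite addrCA.
Qed.

End sum_sumType.

Section robust_duality.
Context {R : realType} {n q : nat} {I T : finType}.
Variable nrm : 'cV[R]_n -> R.
Hypothesis nrmP : is_norm nrm.
Variables (C : 'M[R]_(q, n)) (d : 'cV[R]_q).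
Local Notation Xi := (polytope C d).
Variables (i0 : I) (t0 : T) (a : T -> 'cV[R]_n) (b : T -> R) (xh : I -> 'cV[R]_n).
Variables (p eps U : R).
Hypotheses (p_gt0 : 0 < p) (eps_gt0 : 0 < eps) (xhP : forall i, Xi (xh i)).

(* The unknowns are [lambda], the [s i] and the entries of the [z i t]. *)
Let K : finType := ((unit + I) + I * T * 'I_n)%type.
Let V := 'rV[R]_#|K|.
Let vl (v : V) : R := v 0 (enum_rank (inl (inl tt) : K)).
Let vs (v : V) (i : I) : R := v 0 (enum_rank (inl (inr i) : K)).
Let vz (v : V) (i : I) (t : T) : 'cV[R]_n :=
  \col_k v 0 (enum_rank (inr (i, t, k) : K)).

Let vlP c u v : vl (c *: u + v) = c * vl u + vl v.
Proof. by rewrite /vl !mxE. Qed.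

Let vsP c u v i : vs (c *: u + v) i = c * vs u i + vs v i.
Proof. by rewrite /vs !mxE. Qed.

Let vzP c u v i t : vz (c *: u + v) i t = c *: vz u i t + vz v i t.
Proof. by apply/colP => k; rewrite !mxE. Qed.

(** Any choice of test values is realised by a vector of unknowns, at which the vanishing
    combination of a certificate can be evaluated. *)
Let vex l s z : exists v : V, [/\ vl v = l, forall i, vs v i = s i &
  forall i t, vz v i t = z i t].
Proof.
exists (\row_k match enum_val k : K with
   | inl (inl _) => l | inl (inr i) => s i | inr (i, t, k) => z i t k 0 end).
split=> [|i|i t]; rewrite /vl /vs ?mxE ?enum_rankK//.
by apply/colP => k; rewrite !mxE enum_rankK.
Qed.

(* The inequalities are indexed by triples [(i, t, xi)] with [xi] in the polytope,
   by triples [(i, t, u)] with [u] in the unit ball, and by the budget constraint. *)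
Let J : choiceType := ((I * T * 'cV[R]_n) + (I * T * 'cV[R]_n) + unit)%type.

Let D (j : J) : Prop := match j with
  | inl (inl x) => Xi x.2 | inl (inr x) => nrm x.2 <= 1 | inr _ => True end.

Let A (j : J) (v : V) : R := match j with
  | inl (inl (i, t, xi)) => - dotv (vz v i t) (xi - xh i) - vs v i
  | inl (inr (i, t, u)) => dotv (vz v i t) u - vl v
  | inr _ => vl v * eps + p * \sum_i vs v i
  end.

Let beta (j : J) : R := match j with
  | inl (inl (i, t, xi)) => - (b t + dotv (a t) xi)
  | inl (inr _) => 0
  | inr _ => U
  end.

Let Ascalar j : scalar (A j).
Proof.
case: j => [[[[i t] xi]|[[i t] u]]|[]] c x y; rewrite /A.
- by rewrite vzP vsP dotvDl dotvZl; ring.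
- by rewrite vzP vlP dotvDl dotvZl; ring.
- rewrite vlP; under eq_bigr do rewrite vsP.
  by rewrite big_split/= -mulr_sumr; ring.
Qed.

(** Finitely many inequalities that bound every unknown: at [xi = xh i] they bound [s i] below, at
    [u = 0] they give [0 <= lambda], the budget then bounds [lambda] and [s i] above, and the signed
    normalised basis vectors bound the entries of [z] by [lambda]. *)
Let J0 : seq J :=
  [seq inl (inl (i, t0, xh i)) : J | i <- enum I] ++
  [seq inl (inr (x.1.1.1, x.1.1.2,
     ((-1) ^+ x.2 / nrm (delta_mx x.1.2 0)) *: delta_mx x.1.2 0)) : J
    | x : I * T * 'I_n * bool <- enum ((I * T * 'I_n * bool)%type : finType)] ++
  [:: inl (inr (i0, t0, 0)); inr tt].

Let nrm_delta k : 0 < nrm (delta_mx k 0).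
Proof.
apply: is_norm_gt0 => //; apply/eqP => /matrixP/(_ k 0); rewrite !mxE !eqxx.
by move/eqP; rewrite oner_eq0.
Qed.

Let J0D j : j \in J0 -> D j.
Proof.
rewrite !mem_cat => /orP[/mapP[i _ ->]|/orP[/mapP[[[[i t] k] e] _ ->]|]] /=.
- exact: xhP.
- rewrite (is_normZ nrmP) normrM normr_sign mul1r normfV gtr0_norm//.
  by rewrite mulVf// gt_eqF.
- rewrite !inE => /orP[/eqP->|/eqP->] //=.
  by rewrite (is_norm0 nrmP).
Qed.

Let J0_bounded k : exists M, forall v, (forall j, j \in J0 -> A j v <= beta j) ->
  `|v 0 k| <= M.
Proof.
pose e i := b t0 + dotv (a t0) (xh i).
(* The bound on [lambda] left by the budget once each [s i] is replaced by its lower bound [e i]. *)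
pose L := (U - p * \sum_i e i) / eps.
have facts v : (forall j, j \in J0 -> A j v <= beta j) ->
    [/\ 0 <= vl v <= L, forall i, e i <= vs v i <= (U - p * \sum_i e i) / p + e i &
      forall i t k, `|vz v i t k 0| <= L * nrm (delta_mx k 0)].
  move=> vP.
  have l0 : 0 <= vl v.
    have := vP (inl (inr (i0, t0, 0))); rewrite /J0 !mem_cat !inE eqxx !orbT.
    by rewrite /A /beta dotv0r sub0r oppr_le0; exact.
  have se i : e i <= vs v i.
    have := vP (inl (inl (i, t0, xh i))) => /(_ _)/wrap[|].
      rewrite !mem_cat; apply/orP; left.
      by apply/mapP; exists i => //; rewrite mem_enum.
    by rewrite /A /beta subrr dotv0r oppr0 sub0r lerN2.
  have budget : vl v * eps + p * \sum_i vs v i <= U.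
    by have := vP (inr tt); rewrite /J0 !mem_cat !inE eqxx !orbT; exact.
  have lL : vl v <= L.
    rewrite ler_pdivlMr// lerBrDr (le_trans _ budget)// lerD2l ler_wpM2l ?(ltW p_gt0)//.
    exact: ler_sum.
  split; first by rewrite l0 lL.
    move=> i; rewrite se/= -lerBlDr ler_pdivlMr// mulrC.
    rewrite lerBrDr -mulrDr (le_trans _ budget)// -[leLHS]add0r lerD//.
      by rewrite mulr_ge0// ltW.
    rewrite ler_wpM2l ?(ltW p_gt0)// (bigD1 i)//= [leRHS](bigD1 i)//= addrA.
    by rewrite subrK lerD2l ler_sum.
  move=> i t k'; pose nk := nrm (delta_mx k' 0).
  have sgn (eb : bool) : (-1) ^+ eb * vz v i t k' 0 <= L * nk.
    have := vP (inl (inr (i, t, ((-1) ^+ eb / nk) *: delta_mx k' 0))).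
    move=> /(_ _)/wrap[|].
      rewrite !mem_cat; apply/orP; right; apply/orP; left.
      by apply/mapP; exists (i, t, k', eb) => //; rewrite mem_enum.
    rewrite /A /beta subr_le0 dotvZr.
    have -> : dotv (vz v i t) (delta_mx k' 0) = vz v i t k' 0.
      rewrite dotvE (bigD1 k')//= !mxE !eqxx mulr1 big1 ?addr0// => j jk.
      by rewrite [delta_mx _ _ _ _]mxE (negbTE jk) mulr0.
    rewrite mulrAC ler_pdivrMr ?nrm_delta// => /le_trans; apply.
    by rewrite ler_wpM2r// ltW// nrm_delta.
  apply/ler_normlP; split; last by have := sgn false; rewrite expr0 mul1r.
  by have := sgn true; rewrite expr1 mulN1r.
rewrite -(enum_valK k); case: (enum_val k) => [[[]|i]|[[i t] k']].
- exists L => v /facts[/andP[l0 lL] _ _].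
  by rewrite -/(vl v) ger0_norm.
- exists (`|e i| + `|(U - p * \sum_i e i) / p + e i|) => v /facts[_ /(_ i)/andP[h1 h2] _].
  rewrite -/(vs v i); apply/ler_normlP; split.
    rewrite lerNl; apply: le_trans h1; rewrite lerNl.
    by rewrite (le_trans (ler_norm _))// normrN lerDl.
  by apply: (le_trans h2); rewrite (le_trans (ler_norm _))// lerDr.
- exists (L * nrm (delta_mx k' 0)) => v /facts[_ _ /(_ i t k')].
  by rewrite mxE.
Qed.

Lemma robust_alternative :
  (exists l s z, [/\ l * eps + p * \sum_i s i <= U,
     forall i t xi, Xi xi ->
       b t + dotv (a t) xi - dotv (z i t) (xi - xh i) <= s i &
     forall i t, dual_norm nrm (z i t) <= l]) \/
  (exists (P : I -> T -> R) (xb : I -> T -> 'cV[R]_n),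
    [/\ forall i t, 0 <= P i t, forall i t, Xi (xb i t),
      forall i, \sum_t P i t = p,
      \sum_i \sum_t P i t * nrm (xb i t - xh i) <= eps &
      U < \sum_i \sum_t P i t * (b t + dotv (a t) (xb i t))]).
Proof.
have [[v vP]|[s [us sD [y [y0 yA yb]]]]] :=
    farkas_compact (D := D) (beta := beta) Ascalar J0D J0_bounded.
  left; exists (vl v), (vs v), (vz v); split.
  - exact: (vP (inr tt)).
  - move=> i t xi xiXi; have := vP (inl (inl (i, t, xi))) xiXi.
    by rewrite /A /beta; lra.
  - move=> i t; apply/(dual_norm_leP nrmP) => x x1.
    by have := vP (inl (inr (i, t, x))) x1; rewrite /A /beta subr_le0.
right.
pose LA := pmap (@pick1 _ _ _) s; pose LB := pmap (@pick2 _ _ _) s.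
have LAP x : x \in LA -> Xi x.2.
  by rewrite mem_pmap => /mapP[[[x'|]|] //= xs [->]]; exact: sD xs.
have LBP x : x \in LB -> nrm x.2 <= 1.
  by rewrite mem_pmap => /mapP[[[|x']|] //= xs [->]]; exact: sD xs.
pose pA x := y (inl (inl x)); pose qB x := y (inl (inr x)).
pose r := \sum_(x <- pmap (@pick3 _ _ _) s) y (inr x).
have r_ge0 : 0 <= r by exact: sumr_ge0.
(* The vanishing combination at arbitrary test values. An indicator [c] gives the mass of each
   sample ([PE]), [l = 1] the total weight of the unit-ball inequalities ([qE]), and [z]
   concentrated at one pair the displacement ([mE]). *)
have ident l (c : I -> R) z :
  \sum_(x <- LA) pA x * (- dotv (z x.1.1 x.1.2) (x.2 - xh x.1.1) - c x.1.1)
  + \sum_(x <- LB) qB x * (dotv (z x.1.1 x.1.2) x.2 - l)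
  + r * (l * eps + p * \sum_i c i) = 0.
  have [v [vl_ vs_ vz_]] := vex l c z.
  rewrite -[RHS](yA v) sum_pick /r mulr_suml; congr (_ + _ + _).
  - by apply: eq_bigr => -[[i t] xi] _ /=; rewrite vs_ vz_.
  - by apply: eq_bigr => -[[i t] xi] _ /=; rewrite vl_ vz_.
  - by apply: eq_bigr => -[] _ /=; rewrite vl_; under [in RHS]eq_bigr do rewrite vs_.
have neg : r * U < \sum_(x <- LA) pA x * (b x.1.2 + dotv (a x.1.2) x.2).
  move: yb; rewrite sum_pick [X in _ + X + _]big1/=; last by move=> [[? ?] ?]; rewrite mulr0.
  rewrite addr0 /r mulr_suml [X in X + _](_ : _ =
    - \sum_(x <- LA) pA x * (b x.1.2 + dotv (a x.1.2) x.2)); last first.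
    by rewrite -sumrN; apply: eq_bigr => -[[i t] xi] _ /=; rewrite mulrN.
  by rewrite addrC subr_lt0.
have split2 (W : nmodType) (L : seq (I * T * 'cV[R]_n)) (F : _ -> W) :
    \sum_(x <- L) F x = \sum_i \sum_t \sum_(x <- L | x.1 == (i, t)) F x.
  rewrite (partition_big (fun x => x.1) xpredT)//= pair_bigA/=.
  by apply: eq_bigr => -[i t] _.
pose P i t := \sum_(x <- LA | x.1 == (i, t)) pA x.
pose m i t := \sum_(x <- LA | x.1 == (i, t)) pA x *: x.2.
have P_ge0 i t : 0 <= P i t by apply: sumr_ge0 => x _; exact: y0.
have PE i : \sum_t P i t = r * p.
  have := ident 0 (fun j => (j == i)%:R) (fun _ _ => 0).
  rewrite [X in _ + X + _]big1 ?addr0; last first.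
    by move=> x _; rewrite dotvC dotv0r subr0 mulr0.
  rewrite mul0r add0r (bigD1 i)//= eqxx [X in p * (_ + X)]big1 ?addr0; last by move=> j /negbTE->.
  rewrite mulr1 split2 (bigD1 i)//= [X in _ + X + _]big1 ?addr0; last first.
    move=> j /negbTE ji; rewrite big1// => t _; rewrite big1// => x /eqP ->/=.
    by rewrite dotvC dotv0r ji oppr0 ?mulr0n ?subr0 ?addr0 mulr0.
  move/eqP; rewrite addrC addr_eq0 => /eqP ->; rewrite -sumrN; apply: eq_bigr => t _.
  rewrite -sumrN; apply: eq_bigr => x /eqP -> /=.
  by rewrite eqxx dotvC dotv0r oppr0 sub0r mulrN mulr1 opprK.
have qE : \sum_(x <- LB) qB x = r * eps.
  have := ident 1 (fun=> 0) (fun _ _ => 0).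
  rewrite [X in X + _ + _]big1 ?add0r; last first.
    by move=> x _; rewrite dotvC dotv0r subr0 oppr0 mulr0.
  rewrite big1_eq mulr0 addr0 mul1r => /eqP; rewrite addrC addr_eq0 => /eqP ->.
  rewrite -sumrN; apply: eq_bigr => x _.
  by rewrite dotvC dotv0r sub0r mulrN mulr1 opprK.
have mE i t : m i t - P i t *: xh i = \sum_(x <- LB | x.1 == (i, t)) qB x *: x.2.
  apply: dotv_inj => w.
  have dotv_sum (L : seq _) (Q : pred _) (F : I * T * 'cV[R]_n -> 'cV[R]_n) :
      dotv w (\sum_(x <- L | Q x) F x) = \sum_(x <- L | Q x) dotv w (F x).
    by apply: (big_morph (dotv w)); [exact: dotvDr | exact: dotv0r].
  pose z j k : 'cV[R]_n := if (j, k) == (i, t) then w else 0.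
  have := ident 0 (fun=> 0) z.
  rewrite big1_eq mulr0 mul0r addr0 mulr0 addr0 !split2.
  have only (W : I -> T -> R) : (forall j k, (j, k) != (i, t) -> W j k = 0) ->
      \sum_j \sum_k W j k = W i t.
    move=> W0; rewrite pair_bigA (bigD1 (i, t))//= big1 ?addr0// => -[j k] /=.
    exact: W0.
  rewrite (only (fun j k => \sum_(x <- LA | x.1 == (j, k)) _))/=; last first.
    move=> j k /negbTE jk; rewrite big1// => x /eqP -> /=.
    by rewrite /z jk dotvC dotv0r oppr0 ?subr0 ?addr0 mulr0.
  rewrite (only (fun j k => \sum_(x <- LB | x.1 == (j, k)) _))/=; last first.
    move=> j k /negbTE jk; rewrite big1// => x /eqP -> /=.
    by rewrite /z jk dotvC dotv0r subr0 mulr0.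
  move/eqP; rewrite addrC addr_eq0 => /eqP e.
  rewrite dotv_sum [RHS](_ : _ = \sum_(x <- LB | x.1 == (i, t))
      qB x * (dotv (z x.1.1 x.1.2) x.2 - 0)); last first.
    by apply: eq_bigr => x /eqP -> /=; rewrite /z eqxx subr0 dotvZr.
  rewrite e -sumrN dotvBr dotv_sum dotvZr /P mulr_suml -sumrB; apply: eq_bigr.
  by move=> x /eqP -> /=; rewrite /z eqxx dotvZr subr0 dotvBr; ring.
have m0 i t : P i t = 0 -> m i t = 0.
  move/eqP; rewrite psumr_eq0 => [/allP h|x _]; last exact: y0.
  rewrite /m big_seq_cond big1// => x /andP[xL xit].
  by have /= := h _ xL; rewrite xit/= => /eqP ->; rewrite scale0r.
(* Without mass the barycentre is undefined; the sample itself is a default value inside the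
   polytope. *)
pose xb i t := if P i t == 0 then xh i else (P i t)^-1 *: m i t.
have PxbE i t : P i t *: xb i t = m i t.
  rewrite /xb; case: eqVneq => [P0|P0]; last by rewrite scalerA divff// scale1r.
  by rewrite P0 scale0r m0.
have negE : \sum_(x <- LA) pA x * (b x.1.2 + dotv (a x.1.2) x.2) =
    \sum_i \sum_t P i t * (b t + dotv (a t) (xb i t)).
  rewrite split2; apply: eq_bigr => i _; apply: eq_bigr => t _.
  rewrite mulrDr -dotvZr PxbE /m (big_morph (dotv (a t)) (dotvDr _) (dotv0r _)).
  rewrite /P mulr_suml -big_split/=; apply: eq_bigr => x /eqP -> /=.
  by rewrite mulrDr dotvZr.
(* If the budget had multiplier 0, all masses [P i t] would vanish by [PE], and [neg] would read
   [0 < 0]. *)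
have r_gt0 : 0 < r.
  rewrite lt_def r_ge0 andbT; apply/eqP => r0; move: neg; rewrite r0 mul0r negE.
  rewrite big1 ?ltxx// => i _; rewrite big1// => t _.
  have := PE i; rewrite r0 mul0r => /eqP; rewrite psumr_eq0 => [/allP/(_ t)|//].
  by rewrite mem_index_enum => /(_ isT)/= /eqP ->; rewrite mul0r.
exists (fun i t => r^-1 * P i t), xb; split.
- by move=> i t; rewrite mulr_ge0// invr_ge0.
- move=> i t; rewrite /xb; case: eqVneq => // P0; apply: polytope_barycenter.
  + by move=> x; exact: y0.
  + by move=> x /LAP.
  + by rewrite lt_def P0 P_ge0.
- by move=> i; rewrite -mulr_sumr PE mulKf// gt_eqF.
(* By [mE] each displacement is a combination of vectors of the unit ball, and by [qE] the weights
   total [r * eps]; the triangle inequality concludes. *)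
- under eq_bigr do (under eq_bigr do rewrite -mulrA; rewrite -mulr_sumr).
  rewrite -mulr_sumr ler_pdivrMl// -qE split2 ler_sum// => i _; rewrite ler_sum// => t _.
  rewrite -[X in X * _](ger0_norm (P_ge0 i t)) -(is_normZ nrmP) scalerBr PxbE mE.
  rewrite (@le_trans _ _ (\sum_(x <- LB | x.1 == (i, t)) nrm (qB x *: x.2)))//.
    elim/big_ind2 : _ => [|x1 x2 y1 y2 h1 h2|//]; first by rewrite is_norm0.
    by rewrite (le_trans (is_normD nrmP _ _))// lerD.
  rewrite big_seq_cond [leRHS]big_seq_cond ler_sum// => x /andP[/LBP x1 _].
  by rewrite (is_normZ nrmP) ger0_norm ?y0// ler_piMr// y0.
- under eq_bigr do (under eq_bigr do rewrite -mulrA; rewrite -mulr_sumr).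
  by rewrite -mulr_sumr ltr_pdivlMl// -negE.
Qed.

End robust_duality.

(** * Borel structure and finitely supported laws *)

Section borel.
Context {R : realType} {n : nat}.
Local Notation T := (borelV R n).

Lemma continuous_measurable_cV (f : 'cV[R]_n -> R) :
  continuous f -> measurable_fun [set: T] (f : T -> R).
Proof.
move=> cf; apply: (measurability _ (RGenOpens.measurableE R)).
move=> _ [_ [a [b ->] <-]]; rewrite setTI; apply: sub_sigma_algebra.
by apply: open_comp => [x _|]; [exact: cf | exact: interval_open].
Qed.

Lemma measurable_coord i : measurable_fun [set: T] (fun x : T => (x : 'cV[R]_n) i 0).
Proof. by apply: continuous_measurable_cV; exact: coord_continuous. Qed.

Lemma measurable_dotv (a : 'cV[R]_n) : measurable_fun [set: T] (dotv a : T -> R).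
Proof. by apply: continuous_measurable_cV; apply: scalar_continuous => c x y; exact: dotvP. Qed.

Lemma measurable_is_norm (nrm : 'cV[R]_n -> R) : is_norm nrm ->
  measurable_fun [set: T] (nrm : T -> R).
Proof. by move=> nrmP; apply: continuous_measurable_cV; exact: is_norm_continuous. Qed.

Lemma measurable_polytope q (C : 'M[R]_(q, n)) d :
  measurable (polytope C d : set T).
Proof.
have -> : polytope C d = \bigcap_(i in [set: 'I_q]) [set xi | (C *m xi) i 0 <= d i 0].
  by apply/seteqP; split => [x xP i _|x xP i]; [exact: xP | exact: (xP i I)].
apply: fin_bigcap_measurable => // i _.
have mf : measurable_fun [set: T] (fun xi : T => (C *m (xi : 'cV[R]_n)) i 0 : R).
  apply: continuous_measurable_cV; apply: scalar_continuous => c x y.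
  by rewrite mulmxDr -scalemxAr !mxE.
have := mf measurableT _ (measurable_itv `]-oo, d i 0]).
by rewrite setTI; congr measurable; apply/seteqP; split=> x /=; rewrite in_itv.
Qed.

(** A singleton is the polytope given by [y <= x] and [- y <= - x]. *)
Lemma measurable_cV1 (x : 'cV[R]_n) : measurable ([set x] : set T).
Proof.
have -> : [set x] = polytope (col_mx 1%:M (- 1%:M)) (col_mx x (- x)).
  apply/seteqP; split => [_ -> i|y yx]; first by rewrite mul_col_mx mulNmx !mul1mx.
  apply/colP => i; apply/eqP; rewrite eq_le.
  have := yx (lshift n i); rewrite mul_col_mx mul1mx !col_mxEu => ->.
  by have := yx (rshift n i); rewrite mul_col_mx mulNmx mul1mx !col_mxEd !mxE lerN2.
exact: measurable_polytope.
Qed.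

Let box (c : {ffun 'I_n -> rat}) (k : nat) : set 'cV[R]_n :=
  [set x | forall i, `|x i 0 - ratr (c i)| < k.+1%:R^-1].

Let open_boxes (U : set 'cV[R]_n) : open U ->
  U = \bigcup_(c : {ffun 'I_n -> rat} * nat)
        (if `[< box c.1 c.2 `<=` U >] then box c.1 c.2 else set0).
Proof.
move=> oU; apply/seteqP; split => [x Ux|x [c _]]; last first.
  by case: asboolP => // + bx; exact.
have /nbhs_ballP[e /= e0 eU] : nbhs x U by exact: open_nbhs_nbhs.
(* Two points of a box differ by less than twice its radius [1 / (k + 1)] in each coordinate, so
   this sum must stay below [e]. *)
pose k := Num.truncn (2 / e).
have ke : k.+1%:R^-1 + k.+1%:R^-1 < e.
  have : 2 / e < k.+1%:R by rewrite Num.Theory.truncnS_gt.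
  by rewrite ltr_pdivrMr// => h; rewrite -mulr2n -(mulr_natr _ 2) ltr_pdivrMl.
have /choice[c cP] i : exists q : rat, `|x i 0 - ratr q| < k.+1%:R^-1.
  have : x i 0 - k.+1%:R^-1 < x i 0 + k.+1%:R^-1.
    by rewrite ltrBlDr -addrA ltrDl addr_gt0// invr_gt0.
  move=> /rat_in_itvoo[q]; rewrite in_itv/= => /andP[q1 q2]; exists q.
  by rewrite ltr_distlC q1.
have bx : box (finfun c) k x by move=> i; rewrite ffunE.
exists (finfun c, k) => //=; case: asboolP => // -[].
move=> y yc; apply: eU; split=> // i j; rewrite (ord1 j) -ball_normE /ball_ /=.
rewrite -(subrKA (ratr (finfun c i))) (le_lt_trans (ler_normD _ _))//.
rewrite (lt_trans _ ke)// ltrD// distrC; exact: yc.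
Qed.

(** Open sets generate the Borel sets and are countable unions of rational boxes, whose preimages
    are finite intersections of conditions on single coordinates. *)
Lemma measurable_cVP d (S : measurableType d) (D : set S) (f : S -> T) :
  measurable D ->
  (forall i, measurable_fun D (fun s => (f s : 'cV[R]_n) i 0)) ->
  measurable_fun D f.
Proof.
move=> mD mf; apply: (@measurability _ _ _ T D f (@open 'cV[R]_n)) => // _ [U oU <-].
rewrite [U]open_boxes// preimage_bigcup setI_bigcupr.
apply: countable_bigcupT_measurable; first exact: countableP.
move=> [c k] /=; case: asboolP => _; last by rewrite preimage_set0 setI0.
have -> : D `&` f @^-1` box c k = D `&` \bigcap_(i in [set: 'I_n])
    (D `&` (fun s => (f s : 'cV[R]_n) i 0) @^-1` [set r | `|r - ratr (c i)| < k.+1%:R^-1]).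
  apply/seteqP; split => [s [Ds bs]|s [Ds bs]]; split=> // i; last by case: (bs i I).
  by move=> _; split=> //; exact: bs.
apply: measurableI => //; apply: fin_bigcap_measurable => // i _.
apply: mf => //.
have -> : [set r | `|r - ratr (c i)| < k.+1%:R^-1] =
    `]ratr (c i) - k.+1%:R^-1, ratr (c i) + k.+1%:R^-1[%classic :> set R.
  by apply/seteqP; split=> r /=; rewrite in_itv/= ltr_distl.
exact: measurable_itv.
Qed.

End borel.

(** The source carries the product of two Borel sigma-algebras, so the check is by coordinates
    instead of by continuity. *)
Lemma measurable_subV (R : realType) (n : nat) :
  measurable_fun setT (fun z : (borelV R n * borelV R n)%type =>
    ((z.1 : 'cV[R]_n) - z.2 : borelV R n)).
Proof.
apply: measurable_cVP => // i.
rewrite (_ : (fun s => _) = (fun z : (borelV R n * borelV R n)%type =>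
   (z.1 : 'cV[R]_n) i 0) \- (fun z => (z.2 : 'cV[R]_n) i 0)); last first.
  by apply/funext => z; rewrite !mxE.
by apply: measurable_funB; apply: (measurableT_comp (measurable_coord i)).
Qed.

Section discrete.
Context d (T : measurableType d) (R : realType) (K : finType).
Variables (p : K -> R) (x : K -> T).
Hypotheses (p_ge0 : forall k, 0 <= p k) (p_sum : \sum_k p k = 1).

Lemma discrete_probability : exists Q : probability T R,
  (forall A, Q A = (\sum_k (p k)%:E * \d_(x k) A)%E) /\
  forall (D : set T) (f : T -> R), measurable D -> (forall k, D (x k)) ->
    measurable_fun D f ->
    (\int[Q]_(y in D) (f y)%:E)%E = (\sum_k p k * f (x k))%:E.
Proof.
pose pn (k : K) : {nonneg R} := NngNum (p_ge0 k).
(* A finite sum of measures is taken along a sequence, so the atoms are enumerated by naturals, with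
   the zero measure past the last one. *)
pose m (i : nat) : {measure set T -> \bar R} :=
  if insub i is Some j then mscale (pn (enum_val (j : 'I_#|K|))) (dirac (x (enum_val j)))
  else mzero.
pose mu : {measure set T -> \bar R} := msum m #|K|.
have mE (i : 'I_#|K|) A : m i A = ((p (enum_val i))%:E * \d_(x (enum_val i)) A)%E.
  by rewrite /m valK.
have reidx (F : K -> \bar R) :
    (\sum_k F k = \sum_(i < #|K|) F (enum_val i))%E.
  by rewrite -(big_enum_val F); apply: eq_bigl.
have muE A : mu A = (\sum_k (p k)%:E * \d_(x k) A)%E.
  rewrite /mu /= /msum reidx.
  by apply: eq_bigr => i _; rewrite mE.
have muT : mu setT = 1%E.
  rewrite muE; under eq_bigr do rewrite diracT mule1.
  by rewrite sumEFin p_sum.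
pose Q : probability T R := HB.pack (Measure.sort mu)
  (Measure_isProbability.Build _ _ _ mu muT).
exists Q; split; first exact: muE.
move=> D f mD Dx mf.
have ge0 (g : T -> R) : measurable_fun D g -> (forall y, 0 <= g y) ->
    (\int[mu]_(y in D) (g y)%:E)%E = (\sum_k p k * g (x k))%:E.
  move=> mg g0; rewrite ge0_integral_measure_sum//; last 2 first.
  - by move=> y _; rewrite lee_fin.
  - exact/measurable_EFinP.
  rewrite -sumEFin reidx.
  apply: eq_bigr => i _; rewrite /m valK ge0_integral_mscale//; last 2 first.
  - exact/measurable_EFinP.
  - by move=> y _; rewrite lee_fin.
  rewrite integral_dirac//; last exact/measurable_EFinP.
  by rewrite diracE mem_set ?mul1e.
change ((\int[mu]_(y in D) (f y)%:E)%E = (\sum_k p k * f (x k))%:E).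
(* A signed function is split into its two parts; both integrals are finite sums of reals, so their
   difference is an ordinary one. *)
rewrite integralE.
under eq_integral do rewrite funeposE /= -EFin_max.
under [X in (_ - X)%E]eq_integral do rewrite funenegE /= -EFin_max.
rewrite !ge0//; last 4 first.
- by apply: measurable_maxr => //; exact: measurableT_comp.
- by move=> y; rewrite le_max lexx orbT.
- by apply: measurable_maxr.
- by move=> y; rewrite le_max lexx orbT.
rewrite -EFinB -sumrB; congr EFin; apply: eq_bigr => k _.
rewrite -mulrBr/=; congr (_ * _); have [h|/ltW h] := leP 0 (f (x k)).
  by rewrite max_r ?oppr_le0// subr0.
by rewrite max_l ?oppr_ge0// sub0r opprK.
Qed.

End discrete.

(** * Wasserstein balls *)

Section law.
Local Open Scope ereal_scope.
Context d1 d2 (X : measurableType d1) (Y : measurableType d2) (R : realType).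
Variables (phi : X -> Y) (mu : {measure set X -> \bar R})
  (nu : {measure set Y -> \bar R}).
Hypothesis mphi : measurable_fun [set: X] phi.
Hypothesis nuE : forall A, measurable A -> nu A = mu (phi @^-1` A).

(** Agreement with the pushforward on measurable sets is the form in which both the marginals of a
    coupling and the law of the disturbance window are given. *)
Lemma law_ge0_integral (f : Y -> \bar R) : measurable_fun [set: Y] f ->
  (forall y, 0 <= f y) -> \int[nu]_y f y = \int[mu]_x f (phi x).
Proof.
move=> mf f0; rewrite (eq_measure_integral (pushforward mu phi)); last first.
  by move=> A mA _; rewrite nuE.
by rewrite ge0_integral_pushforward.
Qed.

Lemma law_integrable (f : Y -> \bar R) : measurable_fun [set: Y] f ->
  nu.-integrable [set: Y] f <-> mu.-integrable [set: X] (f \o phi).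
Proof.
move=> mf.
have E : \int[nu]_y `|f y| = \int[mu]_x `|f (phi x)|.
  by rewrite (law_ge0_integral (f := fun y => `|f y|))//; exact: measurableT_comp.
split=> /integrableP[_ h]; apply/integrableP; split=> //.
- exact: measurableT_comp.
- by rewrite -E.
- by rewrite E.
Qed.

Lemma law_integral (f : Y -> \bar R) : nu.-integrable [set: Y] f ->
  \int[nu]_y f y = \int[mu]_x f (phi x).
Proof.
move=> intf; have mf := measurable_int _ intf.
rewrite (eq_measure_integral (pushforward mu phi)); last first.
  by move=> A mA _; rewrite nuE.
by rewrite integral_pushforward//; exact/(law_integrable mf).
Qed.

End law.

Section full_measure.
Local Open Scope ereal_scope.
Context d (T : measurableType d) (R : realType) (P : probability T R) (A : set T).
Hypotheses (mA : measurable A) (PA : P A = 1).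

Lemma full_setC : P (~` A) = 0.
Proof. by rewrite probability_setC// PA subee. Qed.

Lemma full_integral (f : T -> \bar R) : P.-integrable [set: T] f ->
  \int[P]_x f x = \int[P]_(x in A) f x.
Proof.
move=> intf; have mN : measurable (~` A) by exact: measurableC.
by rewrite (negligible_integral mN measurableT intf full_setC) setTD setCK.
Qed.

Lemma full_ge0_integral (f : T -> \bar R) : measurable_fun [set: T] f ->
  (forall x, 0 <= f x) -> \int[P]_x f x = \int[P]_(x in A) f x.
Proof.
move=> mf f0; have mN : measurable (~` A) by exact: measurableC.
by rewrite (ge0_negligible_integral mN measurableT mf _ full_setC)// setTD setCK.
Qed.

Lemma full_integrable (f : T -> \bar R) : measurable_fun [set: T] f ->
  P.-integrable A f -> P.-integrable [set: T] f.
Proof.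
move=> mf /integrableP[_ h]; apply/integrableP; split=> //.
by rewrite full_ge0_integral//; exact: measurableT_comp.
Qed.

End full_measure.

Section wasserstein_ball.
Context {R : realType} {n q Ns : nat}.
Local Notation T := (borelV R n).
Variable nrm : 'cV[R]_n -> R.
Hypothesis nrmP : is_norm nrm.
Variables (C : 'M[R]_(q, n)) (d : 'cV[R]_q) (sample : 'I_Ns -> 'cV[R]_n).
Local Notation Xi := (polytope C d).
Hypotheses (Ns_gt0 : (0 < Ns)%N) (sampleP : forall i, Xi (sample i)).

Let mXi : measurable (Xi : set T).
Proof. exact: measurable_polytope. Qed.

Let mnrm : measurable_fun [set: T] (nrm : T -> R).
Proof. exact: measurable_is_norm. Qed.

(** Supported laws have a finite first moment over [Xi], which extends to the whole space because
    [Xi] has mass 1. *)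
Lemma supported_integrable (Q : probability T R) (f : T -> R) (c L : R) :
  supported nrm Xi Q -> measurable_fun [set: T] f ->
  (forall xi, `|f xi| <= c + L * nrm xi) ->
  Q.-integrable [set: T] (EFin \o f).
Proof.
move=> [QXi Qn] mf fle.
have intn : Q.-integrable [set: T] (EFin \o (nrm : T -> R)).
  apply: (full_integrable mXi) => //; first exact/measurable_EFinP.
  apply/integrableP; split; first by apply/measurable_EFinP; exact: measurable_funTS.
  under eq_integral do rewrite /= ger0_norm ?is_norm_ge0//.
  exact: Qn.
apply: (@le_integrable _ _ _ _ _ _ _ (EFin \o (fun xi => c + L * nrm xi) : T -> \bar R)) => //.
- exact/measurable_EFinP.
- by move=> x _ /=; rewrite lee_fin (le_trans (fle x))// ler_norm.
- rewrite (_ : EFin \o _ = (EFin \o cst c) \+ (fun x => L%:E * (EFin \o nrm) x))%E; last first.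
    by apply/funext => x /=; rewrite EFinD EFinM.
  apply: integrableD => //; first exact: finite_measure_integrable_cst.
  exact: integrableZl.
Qed.

Lemma empirical_probability : exists Qh : probability T R,
  (forall A, Qh A = empirical sample A) /\
  forall (D : set T) (f : T -> R), measurable D -> (forall k, D (sample k)) ->
    measurable_fun D f ->
    (\int[Qh]_(y in D) (f y)%:E)%E = (Ns%:R^-1 * \sum_i f (sample i))%:E.
Proof.
have Ns0 : (Ns%:R : R) != 0 by rewrite pnatr_eq0 -lt0n.
have [||Qh [QhE Qhint]] := @discrete_probability _ T R _
  (fun=> Ns%:R^-1) (sample : 'I_Ns -> T).
- by move=> _; rewrite invr_ge0.
- by rewrite sumr_const card_ord -[_ *+ _]mulr_natr mulVf.
exists Qh; split=> [A|D f mD Ds mf].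
  by rewrite QhE /empirical ge0_sume_distrr.
by rewrite Qhint// mulr_sumr.
Qed.

(** Weak duality: the pointwise bound is integrated against a coupling, whose first marginal yields
    the average of the [s i] and whose cost multiplies [lambda]. *)
Lemma wball_expectation_le (alpha eps : R) (Q : probability T R) (f : T -> R)
    (c L lambda U : R) (s : 'I_Ns -> R) :
  wball nrm Xi alpha eps sample Q -> measurable_fun [set: T] f ->
  (forall xi, `|f xi| <= c + L * nrm xi) -> 0 <= lambda ->
  (forall i xi, Xi xi -> f xi <= s i + lambda * nrm (xi - sample i)) ->
  lambda * eps + Ns%:R^-1 * \sum_i s i <= U ->
  ('E_Q[f] <= U%:E)%E.
Proof.
move=> [Qsupp _ Qw] mf fL lambda0 fs sU.
have Qf := supported_integrable Qsupp mf fL.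
rewrite unlock; apply/lee_addgt0Pr => e e0.
(* The infimum over couplings may not be attained, so the cost is allowed to exceed [eps] by [e'].
   This costs [lambda * e' <= e], also when [lambda = 0]. *)
pose e' := e / (lambda + 1).
have l1 : 0 < lambda + 1 by rewrite ltr_wpDl.
have e'0 : 0 < e' by rewrite divr_gt0.
have : (wasserstein nrm Xi (empirical sample) Q < (eps + e')%:E)%E.
  by rewrite (le_lt_trans Qw)// lte_fin ltrDl.
move=> /ereal_inf_lt[_ [Pi Pic <-] Pilt].
(* The pointwise bound concerns pairs of a sample and a point of [Xi]; every coupling gives such
   pairs probability 1. *)
pose D1 : set T := [set y | exists i, y = sample i].
have D1E : D1 = \bigcup_(i in [set: 'I_Ns]) [set (sample i : T)].
  by apply/seteqP; split=> [y [i ->]|y [i _ ->]]; exists i.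
have mD1 : measurable D1.
  by rewrite D1E; apply: fin_bigcup_measurable => // i _; exact: measurable_cV1.
pose D := D1 `*` (Xi : set T).
have mD : measurable D by exact: measurableX.
have [Qh [QhE Qhint]] := empirical_probability.
have fstE A : measurable A -> Qh A = Pi (fst @^-1` A).
  by move=> mA; rewrite QhE; have [] := Pic _ mA.
have sndE A : measurable A -> Q A = Pi (snd @^-1` A).
  by move=> mA; have [] := Pic _ mA.
have PiD1 : Pi (fst @^-1` D1) = 1%E.
  rewrite -fstE// QhE /empirical (eq_bigr (fun=> 1%:E)) => [|i _].
    rewrite sumEFin sumr_const card_ord -EFinM mulVf//.
    by rewrite pnatr_eq0 -lt0n.
  by rewrite diracE mem_set//; exists i.
have PiXi : Pi (snd @^-1` (Xi : set T)) = 1%E.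
  by rewrite -sndE//; case: Qsupp.
have PiD : Pi D = 1%E.
  have mfst : measurable (fst @^-1` D1 : set (T * T)).
    by rewrite -[X in measurable X]setTI; exact: measurable_fst.
  have msnd : measurable (snd @^-1` (Xi : set T) : set (T * T)).
    by rewrite -[X in measurable X]setTI; exact: measurable_snd.
  have : Pi (~` D) = 0%E.
    apply/eqP; rewrite eq_le measure_ge0 andbT.
    have -> : ~` D = ~` (fst @^-1` D1) `|` ~` (snd @^-1` (Xi : set T)).
      by rewrite -setCI.
    rewrite (le_trans (measureU2 _ _ _))//; [exact: measurableC | exact: measurableC |].
    rewrite [X in (X + _)%E](full_setC mfst PiD1).
    by rewrite [X in (_ + X)%E](full_setC msnd PiXi) adde0.
  move=> PiDC; rewrite -[D]setCK probability_setC; last exact: measurableC.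
  by rewrite [X in (_ - X)%E]PiDC sube0.
have mfsnd : measurable_fun [set: T * T] (fun z : T * T => f z.2).
  exact: (measurableT_comp mf measurable_snd).
have mdist : measurable_fun [set: T * T]
    (fun z : T * T => nrm ((z.1 : 'cV[R]_n) - z.2)).
  exact: (measurableT_comp mnrm (@measurable_subV R n)).
have fPi : Pi.-integrable [set: T * T] (fun z => (f z.2)%:E).
  by have := (law_integrable measurable_snd sndE (f := EFin \o f)
    ((measurable_EFinP _ _).2 mf)).1 Qf.
(* Samples may coincide, so the bound attached to a point is the least [s i]
   among the samples located there. *)
pose S (y : T) : R := inf [set s i | i in [set i | sample i = y]].
have S_lb i xi : Xi xi -> lbound [set s i' | i' in [set i' | sample i' = sample i]]
    (f xi - lambda * nrm (xi - sample i)).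
  by move=> xiXi _ [i' /= <- <-]; rewrite lerBlDr; exact: fs.
have S_le i : S (sample i) <= s i.
  apply: ge_inf; last by exists i.
  by exists (f (sample i) - lambda * nrm (sample i - sample i)); exact: S_lb.
have le_S i xi : Xi xi -> f xi <= S (sample i) + lambda * nrm (xi - sample i).
  by move=> xiXi; rewrite -lerBlDr; apply: lb_le_inf; [exists (s i), i | exact: S_lb].
have mSD1 : measurable_fun D1 S.
  move=> _ B mB.
  have -> : D1 `&` S @^-1` B = \bigcup_(i in [set i | B (S (sample i))])
      [set (sample i : T)].
    apply/seteqP; split => [_ [[i ->] Bi]|_ [i Bi ->]]; first by exists i.
    by split=> //; exists i.
  apply: fin_bigcup_measurable => [|i _]; first exact: finite_finset.
  exact: measurable_cV1.
(* Extension by 0 off the samples gives a bounded measurable function on the whole space. *)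
pose S1 := S \_ D1.
have mS1 : measurable_fun [set: T] S1 by exact: (measurable_restrictT _ mD1).1.
have S1E i : S1 (sample i) = S (sample i).
  by rewrite /S1 patchE mem_set//; exists i.
have S1bnd y : `|S1 y| <= \sum_i `|S (sample i)|.
  rewrite /S1 patchE; case: ifPn => [/set_mem[i ->]|_]; last first.
    by rewrite normr0 sumr_ge0.
  by rewrite (bigD1 i)//= lerDl sumr_ge0.
have intS1 (P : probability T R) : P.-integrable [set: T] (EFin \o S1).
  apply: measurable_bounded_integrable => //.
    by rewrite (le_lt_trans (probability_le1 _ _))// ltry.
  exists (\sum_i `|S (sample i)|); split=> [|x xM y _]; first exact: num_real.
  exact: le_trans (S1bnd y) (ltW xM).
have S1Pi : Pi.-integrable [set: T * T] (fun z => (S1 z.1)%:E).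
  by have := (law_integrable measurable_fst fstE (f := EFin \o S1)
    ((measurable_EFinP _ _).2 mS1)).1 (intS1 Qh).
have intS1E : (\int[Pi]_(z in D) (S1 z.1)%:E <= (Ns%:R^-1 * \sum_i s i)%:E)%E.
  rewrite -full_integral//.
  have <- : (\int[Qh]_y (S1 y)%:E = \int[Pi]_z (S1 z.1)%:E)%E.
    exact: (law_integral measurable_fst fstE (f := EFin \o S1) (intS1 Qh)).
  rewrite Qhint// lee_fin ler_wpM2l ?invr_ge0// ler_sum// => i _.
  by rewrite S1E.
have mDist : measurable_fun setT (fun z : T * T => (nrm ((z.1 : 'cV[R]_n) - z.2))%:E).
  exact/measurable_EFinP.
(* [D] lies in [Xi] times [Xi] because the samples do, and the integrand is nonnegative. *)
have distD : (\int[Pi]_(z in D) (nrm ((z.1 : 'cV[R]_n) - z.2))%:E < (eps + e')%:E)%E.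
  apply: le_lt_trans Pilt; apply: ge0_subset_integral => //.
  - exact: measurableX.
  - exact: measurable_funTS.
  - by move=> z _; rewrite lee_fin is_norm_ge0.
  - by move=> [z1 z2] [/= [i ->] zXi]; split=> //=; exact: sampleP.
have distPi : Pi.-integrable D (fun z => (nrm ((z.1 : 'cV[R]_n) - z.2))%:E).
  apply/integrableP; split; first exact: measurable_funTS.
  under eq_integral do rewrite /= ger0_norm ?is_norm_ge0//.
  by rewrite (lt_trans distD)// ltry.
have -> : (\int[Q]_y (f y)%:E = \int[Pi]_z (f z.2)%:E)%E.
  exact: (law_integral measurable_snd sndE (f := EFin \o f) Qf).
rewrite (full_integral mD)//.
have S1PiD : Pi.-integrable D (fun z => (S1 z.1)%:E) by exact: integrableS S1Pi.
have distPiZ := integrableZl mD lambda distPi.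
have := le_integral mD (integrableS measurableT mD (@subsetT _ _) fPi)
  (integrableD mD S1PiD distPiZ).
move=> /(_ _)/wrap[|].
  move=> z /set_mem[[i zi] zXi] /=; rewrite -EFinM -EFinD lee_fin zi S1E.
  by rewrite -[_ - z.2]opprB is_normN//; exact: le_S.
move=> /le_trans; apply; rewrite integralD// integralZl//.
have : (lambda%:E * \int[Pi]_(z in D) (nrm ((z.1 : 'cV[R]_n) - z.2))%:E
    <= (lambda * (eps + e'))%:E)%E.
  by rewrite EFinM lee_wpmul2l// ltW.
move=> /(leeD intS1E)/le_trans; apply.
rewrite -!EFinD lee_fin mulrDr addrA [X in X + _]addrC.
have : lambda / (lambda + 1) <= 1 by rewrite ler_pdivrMr// mul1r lerDl.
by move=> le1; rewrite lerD// /e' mulrCA ler_piMr// ltW.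
Qed.

End wasserstein_ball.

(** * Worst-case expectation of a maximum of affine functions *)

Section worst_case.
Context {R : realType} {n q Ns : nat} {T : finType}.
Variable nrm : 'cV[R]_n -> R.
Hypothesis nrmP : is_norm nrm.
Variables (C : 'M[R]_(q, n)) (d : 'cV[R]_q) (sample : 'I_Ns -> 'cV[R]_n).
Local Notation Xi := (polytope C d).
Hypotheses (Ns_gt0 : (0 < Ns)%N) (sampleP : forall i, Xi (sample i)).
Local Notation B := (borelV R n).

(** The pairs [(sample i, xb i t)] with weights [P i t] form a coupling of the empirical law with
    [Q], of cost at most [eps]. Finite support makes the exponential moment finite. *)
Lemma wball_discrete (alpha eps : R) (P : 'I_Ns -> T -> R)
    (xb : 'I_Ns -> T -> 'cV[R]_n) :
  (forall i t, 0 <= P i t) -> (forall i t, Xi (xb i t)) ->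
  (forall i, \sum_t P i t = Ns%:R^-1) ->
  \sum_i \sum_t P i t * nrm (xb i t - sample i) <= eps ->
  exists2 Q : probability B R, wball nrm Xi alpha eps sample Q &
    forall f : B -> R, measurable_fun [set: B] f ->
      ('E_Q[f] = (\sum_i \sum_t P i t * f (xb i t))%R%:E)%E.
Proof.
move=> P0 xbP sumP dist.
have Ns0 : (Ns%:R : R) != 0 by rewrite pnatr_eq0 -lt0n.
pose K : finType := ('I_Ns * T)%type.
have sumP1 : \sum_(k : K) P k.1 k.2 = 1.
  rewrite -(pair_bigA _ (fun i t => P i t))/=; under eq_bigr do rewrite sumP.
  by rewrite sumr_const card_ord -[_ *+ _]mulr_natr mulVf.
have [//|//|Q [QE Qint]] := @discrete_probability _ B R K
  (fun k => P k.1 k.2) (fun k => xb k.1 k.2).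
have [//|//|Pi [PiE Piint]] := @discrete_probability _ (B * B)%type R K
  (fun k => P k.1 k.2) (fun k => (sample k.1 : B, xb k.1 k.2 : B)).
have mXi : measurable (Xi : set B) by exact: measurable_polytope.
have mnrm : measurable_fun [set: B] (nrm : B -> R) by exact: measurable_is_norm.
exists Q; last first.
  by move=> f mf; rewrite unlock Qint// -(pair_bigA _ (fun i t => P i t * f (xb i t))).
split.
- split; last by rewrite Qint// ?ltry//; exact: measurable_funTS.
  rewrite QE (eq_bigr (fun k => (P k.1 k.2)%:E)) ?sumEFin ?sumP1// => k _.
  by rewrite diracE mem_set// mule1.
- rewrite /light_tailed /= Qint ?ltry//; apply: measurable_funTS.
  apply: (measurableT_comp (@measurable_expR R)).
  exact: (measurableT_comp (@measurable_powR R alpha)).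
- apply: (@le_trans _ _ (\int[Pi]_(z in Xi `*` Xi)
      (nrm ((z.1 : 'cV[R]_n) - z.2))%:E)%E).
    apply: ereal_inf_lbound; exists Pi => // S mS; split; rewrite PiE.
      rewrite /empirical ge0_sume_distrr//.
      rewrite -(pair_bigA _ (fun i t => (P i t)%:E *
        \d_((sample i : B, xb i t : B)) (fst @^-1` S)))%E/=.
      apply: eq_bigr => i _; rewrite -(sumP i) -sumEFin ge0_sume_distrl//.
        by move=> t _; rewrite lee_fin.
    by rewrite QE; apply: eq_bigr.
  rewrite Piint//.
  + rewrite lee_fin -(pair_bigA _ (fun i t => P i t * nrm (sample i - xb i t)))/=.
    apply: le_trans dist; rewrite le_eqVlt; apply/orP; left; apply/eqP.
    apply: eq_bigr => i _; apply: eq_bigr => t _.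
    by rewrite -[sample i - _]opprB is_normN.
  + exact: measurableX.
  + by move=> k; split=> /=; [exact: sampleP | exact: xbP].
  + by apply: measurable_funTS; exact: (measurableT_comp mnrm (@measurable_subV R n)).
Qed.

Variables (t0 : T) (a : T -> 'cV[R]_n) (b : T -> R) (f : 'cV[R]_n -> R).
Hypotheses (mf : measurable_fun [set: B] (f : B -> R))
  (f_ub : forall xi t, b t + dotv (a t) xi <= f xi)
  (f_max : forall xi, exists t, f xi = b t + dotv (a t) xi).

Lemma max_affine_le_norm : exists c L, forall xi, `|f xi| <= c + L * nrm xi.
Proof.
have /choice[L LP] t : exists L, 0 <= L /\ forall x, `|dotv (a t) x| <= L * nrm x.
  by have [L L0 LP] := dotv_le_norm nrmP (a t); exists L.
exists (\sum_t `|b t|), (\sum_t L t) => xi; have [t ->] := f_max xi.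
rewrite (le_trans (ler_normD _ _))// lerD//.
  by rewrite (bigD1 t)//= lerDl sumr_ge0.
rewrite (le_trans ((LP t).2 _))// ler_wpM2r ?is_norm_ge0//.
by rewrite (bigD1 t)//= lerDl sumr_ge0// => t' _; exact: (LP t').1.
Qed.

(** On the polytope the linear form of [at_ - z] is at most [s - bt - dotv z xh]. The affine Farkas
    lemma, with [xh] as feasible point, writes [at_ - z] as [C^T *m g], so that [C^T *m g - at_] is
    [- z]. *)
Lemma dual_multiplier (s lambda bt : R) (at_ z xh : 'cV[R]_n) : Xi xh ->
  (forall xi, Xi xi -> bt + dotv at_ xi - dotv z (xi - xh) <= s) ->
  dual_norm nrm z <= lambda ->
  exists g : 'cV[R]_q, [/\ bt + dotv at_ xh + dotv g (d - C *m xh) <= s,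
    dual_norm nrm (C^T *m g - at_) <= lambda & forall l, 0 <= g l 0].
Proof.
move=> xhP xiP zl.
have [|||v vP|y [y0 yE yd]] := @farkas_consequence R 'cV[R]_n 'I_q
    (fun l v => (C *m v) l 0) (fun l => d l 0) (dotv (at_ - z))
    (s - bt - dotv z xh) xh.
- by move=> l c u v; rewrite mulmxDr -scalemxAr !mxE.
- by move=> c u v; rewrite dotvP.
- exact: xhP.
- by have := xiP v vP; rewrite dotvBr dotvBl; lra.
pose g := \col_l y l.
have gE : C^T *m g = at_ - z.
  apply: dotv_inj => w; rewrite dotvC [RHS]dotvC yE /dotv trmx_mul trmxK -mulmxA mxE.
  by apply: eq_bigr => l _; rewrite !mxE.
exists g; split.
- have -> : dotv g (d - C *m xh) = \sum_i y i * d i 0 - dotv (at_ - z) xh.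
    rewrite dotvBr yE !dotvE; congr (_ - _); by apply: eq_bigr => l _; rewrite mxE.
  by rewrite dotvBl; lra.
- rewrite gE addrAC subrr add0r; apply/(dual_norm_leP nrmP) => x x1.
  by rewrite dotvNl -dotvNr; apply: (dual_norm_leP nrmP _ _).1 zl _ _; rewrite is_normN.
- by move=> l; rewrite mxE.
Qed.

(** The increment of the affine function from [xh] to [xi] splits along [C^T *m g]: feasibility of
    [xi] bounds one part by the slack of [xh], the dual norm bounds the other. *)
Lemma multiplier_bound (s lambda bt : R) (at_ xh xi : 'cV[R]_n) (g : 'cV[R]_q) :
  bt + dotv at_ xh + dotv g (d - C *m xh) <= s ->
  dual_norm nrm (C^T *m g - at_) <= lambda -> (forall l, 0 <= g l 0) ->
  Xi xi -> bt + dotv at_ xi <= s + lambda * nrm (xi - xh).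
Proof.
move=> gs gl g0 xiP.
have h1 : dotv (C^T *m g) (xi - xh) <= dotv g (d - C *m xh).
  rewrite /dotv trmx_mul trmxK -mulmxA -!/(dotv _ _) mulmxBr !dotvE ler_sum// => l _.
  by rewrite ler_wpM2l// !mxE lerB//; have := xiP l; rewrite mxE.
have h2 : dotv (C^T *m g - at_) (xh - xi) <= lambda * nrm (xi - xh).
  rewrite (le_trans (dotv_le_dual_norm nrmP _ _))// -[xh - xi]opprB is_normN//.
  by rewrite ler_wpM2r// is_norm_ge0.
move: gs h1 h2; rewrite !dotvBl !dotvBr; lra.
Qed.

Lemma worst_case_expectationP (alpha eps U : R) : 0 < eps ->
  (forall Q, wball nrm Xi alpha eps sample Q -> ('E_Q[f : B -> R] <= U%:E)%E) <->
  exists lambda s (g : 'I_Ns -> T -> 'cV[R]_q),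
    lambda * eps + Ns%:R^-1 * \sum_i s i <= U /\
    forall i t, [/\ b t + dotv (a t) (sample i)
                      + dotv (g i t) (d - C *m sample i) <= s i,
      dual_norm nrm (C^T *m g i t - a t) <= lambda & forall l, 0 <= g i t l 0].
Proof.
move=> eps0; split=> [QU|[lambda [s [g [sU gP]]]] Q Qball]; last first.
  have [c [L fL]] := max_affine_le_norm.
  apply: (wball_expectation_le nrmP Ns_gt0 sampleP (s := s) Qball mf fL) sU.
    (* Any one of the dual-norm constraints forces [0 <= lambda]. *)
    have [_ + _] := gP (Ordinal Ns_gt0) t0.
    by apply: le_trans; exact: dual_norm_ge0.
  move=> i xi xiP; have [t ->] := f_max xi; have [h1 h2 h3] := gP i t.
  exact: (multiplier_bound h1 h2 h3 xiP).
have p0 : 0 < (Ns%:R^-1 : R) by rewrite invr_gt0 ltr0n.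
have := robust_alternative nrmP (Ordinal Ns_gt0) t0 a b U p0 eps0 sampleP.
move=> [[lambda [s [z [sU zP zl]]]]|[P [xb [P0 xbP sumP dist big]]]].
  have /choice[g gP] (it : 'I_Ns * T) := dual_multiplier (sampleP it.1)
    (zP it.1 it.2) (zl it.1 it.2).
  by exists lambda, s, (fun i t => g (i, t)); split=> // i t; exact: gP (i, t).
(* The transported law lies in the ball, and [f] dominates the piece [t] at [xb i t], so its
   expectation exceeds [U]. *)
have [Q Qball QE] := wball_discrete alpha P0 xbP sumP dist.
have := QU _ Qball; rewrite QE// lee_fin => le.
have : U < U; last by rewrite ltxx.
rewrite (lt_le_trans big)// (le_trans _ le)// ler_sum// => i _.
by rewrite ler_sum// => t _; rewrite ler_wpM2l.
Qed.

End worst_case.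

(** * Stacked form of the closed loop *)

Lemma affine_recurrence (R : realType) n (A : 'M[R]_n) (z f : nat -> 'cV[R]_n) t :
  (forall k, z k.+1 = A *m z k + f k) ->
  z t = A ^+ t *m z 0 + \sum_(s < t) A ^+ (t - s.+1) *m f s.
Proof.
have AS k : A ^+ k.+1 = A *m A ^+ k by exact: exprS.
move=> zS; elim: t => [|t IH]; first by rewrite expr0 mul1mx big_ord0 addr0.
rewrite zS IH big_ord_recr/= subnn expr0 mul1mx mulmxDr mulmxA -addrA AS.
congr (_ + (_ + _)); rewrite mulmx_sumr; apply: eq_bigr => s _.
by rewrite mulmxA subSn// AS.
Qed.

Lemma submxcol_mxblock_mul (R : realType) p q m n k
    (B : forall (i : 'I_p) (j : 'I_q), 'M[R]_(m, n)) (z : 'M[R]_(stk q n, k)) i :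
  submxcol (\mxblock_(i < p, j < q) B i j *m z) i
    = \sum_j B i j *m submxcol z j.
Proof.
rewrite mxblockEv -{1}[z]submxcolK mxcol_mul mxcolK.
by rewrite mul_mxrow_mxcol.
Qed.

Lemma qform_mxdiag (R : realType) p n (B : 'I_p -> 'M[R]_n) (z : 'cV[R]_(stk p n)) :
  qform (\mxdiag_(i < p) B i) z = \sum_i qform (B i) (submxcol z i).
Proof.
rewrite /qform -{1 2}[z]submxcolK -mulmxA mul_mxdiag_mxcol tr_mxcol.
by rewrite mul_mxrow_mxcol summxE; apply: eq_bigr => i _; rewrite mulmxA.
Qed.

Lemma qformZ (R : realType) n c (S : 'M[R]_n) z : qform (c *: S) z = c * qform S z.
Proof. by rewrite /qform -scalemxAr -scalemxAl mxE. Qed.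

Lemma qformD (R : realType) n (S S' : 'M[R]_n) z :
  qform (S + S') z = qform S z + qform S' z.
Proof. by rewrite /qform mulmxDr mulmxDl mxE. Qed.

Lemma qform_congr (R : realType) p q (S : 'M[R]_p) (G : 'M[R]_(p, q)) z :
  qform (G^T *m S *m G) z = qform S (G *m z).
Proof. by rewrite /qform trmx_mul !mulmxA. Qed.

Lemma block_ord (R : realType) N n (v : 'cV[R]_(stk N n)) (t : 'I_N) :
  block v t = submxcol v t.
Proof. by rewrite /block valK. Qed.

Section stacked_form.
Context {R : realType} {nx nu ny nw N : nat}.
Variables (sys : lti R nx nu ny nw) (x : 'cV[R]_nx).
Variables (HN : law R nu ny N) (xi : 'cV[R]_(stk N nw)).
Hypothesis HNc : causal HN.

Let A := matA sys.
Let B := matB sys.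
Let C := matC sys.
Let D := matD sys.
Let E := matE sys.
Let wt : 'cV[R]_(1 + stk N nw) := col_mx 1%:M xi.
Let st t := loop sys x HN xi t.

Let err t := ls_x (st t) - ls_xhat (st t).
Let pure t := purified sys (st t) (block xi t).

(** The same input drives the system and its nominal model and cancels in the difference. Hence the
    purified outputs are affine in the disturbance and do not depend on the law. *)
Let errE t : err t = A ^+ t *m x + \sum_(s < t) A ^+ (t - s.+1) *m (C *m block xi s).
Proof.
have e0 : err 0 = x by rewrite /err /= subr0.
rewrite -[X in A ^+ t *m X]e0.
apply: (affine_recurrence (f := fun s => C *m block xi s)) => k.
rewrite /err /= mulmxBr; set u := B *m _.
by rewrite [_ + u + _]addrAC [_ + u in X in _ - X]addrC addrKA addrAC.
Qed.

Let pureE t : pure t = D *m err t + E *m block xi t.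
Proof. by rewrite /pure /purified /err mulmxBr addrAC. Qed.

Let ls_vE t : ls_v (st t) = mkseq pure t.
Proof. by elim: t => //= t IH; rewrite IH mkseqS. Qed.

Lemma purified_stack (t : 'I_N) :
  submxcol (stAy N sys *m x + (stCy N sys + stEy N sys) *m xi) t = pure t.
Proof.
rewrite mulmxDl !submxcolD pureE errE mulmxDr -addrA; congr (_ + _).
  by rewrite /stAy mxcol_mul mxcolK mulmxA.
congr (_ + _).
  rewrite submxcol_mxblock_mul mulmx_sumr.
  rewrite (big_ord_widen N
    (fun s => D *m (A ^+ (t - s.+1) *m (C *m block xi s)))); last exact: ltnW.
  rewrite [RHS]big_mkcond/=; apply: eq_bigr => s _; case: ifP => _; last by rewrite mul0mx.
  by rewrite block_ord !mulmxA.
rewrite submxcol_mxblock_mul (bigD1 t)//= eqxx big1 ?addr0 ?block_ord// => s st'.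
by rewrite eq_sym (negbTE st') mul0mx.
Qed.

Lemma input_stack (t : 'I_N) :
  submxcol (tildeH sys x HN *m wt) t = input sys x HN xi t.
Proof.
have -> : tildeH sys x HN *m wt =
    lawh HN + lawH HN *m (stAy N sys *m x + (stCy N sys + stEy N sys) *m xi).
  rewrite /tildeH -mulmxA /tildeCy /tildeEy add_block_mx !add0r !addr0.
  rewrite /wt mul_block_col mul1mx mul0mx addr0 mulmx1.
  by rewrite -[HN in LHS]hsubmxK mul_row_col mulmx1.
rewrite submxcolD /input /pob_input block_ord; congr (_ + _).
rewrite -[lawH HN]submxblockK submxcol_mxblock_mul.
rewrite (big_ord_widen N (fun s => gain HN t s *m
  (rcons (ls_v (loop sys x HN xi t)) (purified sys (loop sys x HN xi t) (block xi t)))`_s))//.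
rewrite [RHS]big_mkcond/=; apply: eq_bigr => s _; rewrite ltnS.
(* The stacked product runs over all blocks, the loop only over [s <= t]; causality removes the
   remaining blocks. *)
case: leqP => [le_st|lt_ts]; last by rewrite HNc// mul0mx.
rewrite purified_stack /gain !valK/=; congr (_ *m _).
rewrite -/(st t) -/(pure t) ls_vE.
have -> : rcons (mkseq pure t) (pure t) = mkseq pure t.+1.
  by rewrite mkseqS.
by rewrite nth_mkseq// ltnS.
Qed.

Lemma state_stack (t : 'I_N.+1) :
  submxcol (state_map sys x HN *m wt) t = state sys x HN xi t.
Proof.
rewrite /state_map mulmxDl -mulmxA /tildeCx /wt mul_row_col mulmx1 -/wt.
rewrite /state (affine_recurrence (A := A) (z := fun t => ls_x (st t))
  (f := fun t => B *m input sys x HN xi t + C *m block xi t)); last first.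
  by move=> k /=; rewrite -addrA.
rewrite !submxcolD addrCA; congr (_ + _); first by rewrite /stAx mxcol_mul mxcolK.
rewrite !submxcol_mxblock_mul -big_split/=.
rewrite (big_ord_widen N (fun s => A ^+ (t - s.+1) *m
  (B *m input sys x HN xi s + C *m block xi s))); last by rewrite -ltnS.
rewrite [RHS]big_mkcond/=; apply: eq_bigr => s _; case: ifP => _.
  by rewrite input_stack block_ord mulmxDr !mulmxA.
by rewrite !mul0mx addr0.
Qed.

(** The index [t] stands for time [t + 1]: the initial block is skipped, as in [ell]. *)
Lemma state_affine (t : 'I_N) i :
  state sys x HN xi t.+1 i 0 =
  coefb sys x HN t i + dotv (coefa sys x HN t i) xi.
Proof.
rewrite -(state_stack (lift ord0 t)) mxE /coefb /coefa /dotv trmxK.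
set r := state_row sys x HN t i.
have -> : (state_map sys x HN *m wt) (tagnat.Rank (lift ord0 t) i) 0 = (r *m wt) 0 0.
  by rewrite /r /state_row -row_mul [RHS]mxE.
by rewrite -{1}[r]hsubmxK /wt mul_row_col mulmx1 mxE.
Qed.

Lemma cost_qform (c : cost_data R nx nu) :
  cost sys c x HN xi = qform (stM sys x c HN) wt.
Proof.
(* The last block has index [N], where the test [t < N] fails and selects the terminal weight. *)
rewrite /stM qformD !qform_congr /stJx /stJu !qform_mxdiag big_ord_recr/= ltnn qformZ.
rewrite (state_stack ord_max) /cost addrAC; congr (_ + _).
rewrite -big_split; apply: eq_bigr => t _ /=.
by rewrite ltn_ord !qformZ input_stack (state_stack (widen_ord _ t)) mulrDr.
Qed.

End stacked_form.

(** * Moments *)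

Section law_moments.
Local Open Scope ereal_scope.
Context d1 d2 (X : measurableType d1) (Y : measurableType d2) (R : realType).
Variables (phi : X -> Y) (mu : probability X R) (nu : probability Y R).
Hypothesis mphi : measurable_fun [set: X] phi.
Hypothesis nuE : forall A, measurable A -> nu A = mu (phi @^-1` A).

(** Positive and negative parts are transported separately, which covers every measurable
    function. *)
Lemma law_expectation (f : Y -> R) : measurable_fun [set: Y] f ->
  'E_nu[f] = 'E_mu[f \o phi].
Proof.
move=> mf; have mEf : measurable_fun [set: Y] (EFin \o f) by exact/measurable_EFinP.
rewrite unlock integralE [RHS]integralE; congr (_ - _).
  rewrite [LHS](law_ge0_integral mphi nuE (measurable_funepos mEf) (funepos_ge0 _)).
  by apply: eq_integral => x _; rewrite !funeposE.
rewrite [LHS](law_ge0_integral mphi nuE (measurable_funeneg mEf) (funeneg_ge0 _)).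
by apply: eq_integral => x _; rewrite !funenegE.
Qed.

Lemma law_covariance (f g : Y -> R) :
  measurable_fun [set: Y] f -> measurable_fun [set: Y] g ->
  covariance nu f g = covariance mu (f \o phi) (g \o phi).
Proof.
move=> mf mg; rewrite covariance.unlock law_expectation; last first.
  by apply: measurable_funM; apply: measurable_funB.
by rewrite !law_expectation.
Qed.

Lemma law_Lfun2 (f : Y -> R) : measurable_fun [set: Y] f ->
  f \o phi \in Lfun mu 2%:E -> f \in Lfun nu 2%:E.
Proof.
move=> mf; rewrite !inE => /andP[_]; rewrite inE /= => fin.
apply/andP; split; rewrite inE //=.
move: fin; rewrite /finite_norm unlock.
rewrite (law_ge0_integral mphi nuE (f := fun y => `|(EFin \o f) y| `^ 2))//.
  apply: (@measurableT_comp _ _ _ _ _ _ (fun z => z `^ 2)).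
    exact: measurable_poweR.
  by apply: measurableT_comp => //; exact/measurable_EFinP.
by move=> y; exact: poweR_ge0.
Qed.

End law_moments.

(** The law of the pair [(f, g)] agrees with the product of its marginals on rectangles, hence
    everywhere, and Fubini's theorem factors the integral. Square integrability makes the product
    integrable. *)
Lemma expectationM_indep d (S : measurableType d) (R : realType)
    (P : probability S R) (f g : S -> R) :
  measurable_fun [set: S] f -> measurable_fun [set: S] g ->
  f \in Lfun P 2%:E -> g \in Lfun P 2%:E ->
  (forall A B : set R, measurable A -> measurable B ->
     P (f @^-1` A `&` g @^-1` B) = (P (f @^-1` A) * P (g @^-1` B))%E) ->
  ('E_P[f * g] = 'E_P[f] * 'E_P[g])%E.
Proof.
move=> mf mg f2 g2 indep.
have PT : P [set: S] \is a fin_num by rewrite fin_num_measure.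
have f1 := Lfun_subset12 PT f2; have g1 := Lfun_subset12 PT g2.
have fg1 := Lfun2_mul_Lfun1 f2 g2.
have /Lfun1_integrable fi := f1; have /Lfun1_integrable gi := g1.
have /Lfun1_integrable fgi := fg1.
pose X : {RV P >-> R} := HB.pack f (isMeasurableFun.Build _ _ _ _ f mf).
pose Y : {RV P >-> R} := HB.pack g (isMeasurableFun.Build _ _ _ _ g mg).
pose m1 := distribution P X; pose m2 := distribution P Y.
have mpair : measurable_fun [set: S] (fun s => (f s, g s)) by exact: measurable_fun_pair.
pose Z : {mfun S >-> (R * R)%type} :=
  HB.pack (fun s => (f s, g s)) (isMeasurableFun.Build _ _ _ _ _ mpair).
pose m := distribution P Z.
pose h (z : R * R) : \bar R := (z.1 * z.2)%:E.
have mh : measurable_fun [set: R * R] h.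
  by apply/measurable_EFinP; apply: measurable_funM.
have mE (A : set (R * R)) : measurable A -> m A = (m1 \x m2)%E A.
  by move=> mA; rewrite (product_measure_unique (m' := m))// => A1 A2; exact: indep.
have hi : m.-integrable [set: R * R] h.
  by apply: (law_integrable (phi := Z) (mu := P) (nu := m) mpair _ mh).2.
have hi12 : (m1 \x m2)%E.-integrable [set: R * R] h.
  have [_ hfin] := integrableP _ _ _ hi; apply/integrableP; split=> //.
  rewrite (eq_measure_integral m)// => A mA _; exact/esym/mE.
rewrite unlock; have -> : (\int[P]_s ((f * g) s)%:E = \int[m]_z h z)%E.
  by rewrite (law_integral (phi := Z) (mu := P) (nu := m) mpair _ hi).
rewrite (eq_measure_integral (m1 \x m2)%E); last by move=> A mA _; exact: mE.
rewrite -(integral12_prod_meas1 hi12)/=.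
have idm : measurable_fun [set: R] (EFin : R -> \bar R).
  exact/measurable_EFinP.
have i2 : m2.-integrable [set: R] (EFin : R -> \bar R).
  by apply: (law_integrable (phi := Y) (mu := P) (nu := m2) mg _ idm).2.
have i1 : m1.-integrable [set: R] (EFin : R -> \bar R).
  by apply: (law_integrable (phi := X) (mu := P) (nu := m1) mf _ idm).2.
have E1 : (\int[m1]_x x%:E = \int[P]_s (f s)%:E)%E.
  by rewrite (law_integral (phi := X) (mu := P) (nu := m1) mf _ i1).
have E2 : (\int[m2]_x x%:E = \int[P]_s (g s)%:E)%E.
  by rewrite (law_integral (phi := Y) (mu := P) (nu := m2) mg _ i2).
rewrite -E1 -E2; have m2f : (\int[m2]_x x%:E \is a fin_num)%E.
  exact: integrable_fin_num.
have inner x : (\int[m2]_y h (x, y) = x%:E * \int[m2]_y y%:E)%E.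
  rewrite -(integralZl measurableT i2); apply: eq_integral => y _.
  by rewrite /h /= EFinM.
rewrite (eq_integral (fun x => (\int[m2]_y y%:E * x%:E)%E)); last first.
  by move=> x _; rewrite [RHS]muleC; exact: inner.
by rewrite -(fineK m2f) integralZl// muleC.
Qed.

Lemma expectation_sum_fin d (T : measurableType d) (R : realType)
    (P : probability T R) (I : finType) (F : I -> T -> R) :
  (forall i, F i \in Lfun P 1%E) ->
  (fun x => \sum_i F i x) \in Lfun P 1%E /\
  ('E_P[fun x => (\sum_i F i x)%R] = \sum_i 'E_P[F i])%E.
Proof.
move=> FL; have -> : (fun x => \sum_i F i x) = \sum_i F i.
  by apply/funext => x; rewrite fct_sumE.
split; first by apply: rpred_sum => i _; exact: FL.
rewrite -(big_map F xpredT id)/= expectation_sum; first by rewrite big_map.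
by move=> _ /mapP[i _ ->]; exact: FL.
Qed.

Section iid_moments.
Context {R : realType} {nw N : nat}.
Variables (mu : 'cV[R]_nw) (Sigma : 'M[R]_nw).
Local Notation T := (borelV R (stk N nw)).
Variable Q : probability T R.
Hypothesis Qiid : iid_laws mu Sigma Q.

Let coord (k : 'I_(stk N nw)) (xi : T) : R := (xi : 'cV[R]_(stk N nw)) k 0.
Let rk (t : 'I_N) (a : 'I_nw) : 'I_(stk N nw) := @tagnat.Rank N (fun=> nw) t a.

Let rkE k : exists t a, k = rk t a.
Proof. by exists (tagnat.sig1 k), (tagnat.sig2 k); rewrite /rk tagnat.sig2K. Qed.

Let coordE t a : (fun xi : T => submxcol (xi : 'cV[R]_(stk N nw)) t a 0) = coord (rk t a).
Proof. by apply/funext => xi; rewrite mxE. Qed.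

Let coord_L2 k : coord k \in Lfun Q 2%:E.
Proof.
have [t [a ->]] := rkE k.
by have [_ /(_ t)[/(_ a)]] := Qiid; rewrite coordE.
Qed.

Let QT : Q [set: T] \is a fin_num.
Proof. by rewrite fin_num_measure. Qed.

Let coord_L1 k : coord k \in Lfun Q 1%E.
Proof. exact: Lfun_subset12. Qed.

Let coord_mean t a : ('E_Q[coord (rk t a)] = (mu a 0)%:E)%E.
Proof. by have [_ /(_ t)[_ /(_ a)]] := Qiid; rewrite coordE. Qed.

Let coord_second t a s b : ('E_Q[coord (rk t a) * coord (rk s b)] =
  ((if t == s then Sigma a b else 0) + mu a 0 * mu b 0)%:E)%E.
Proof.
case: eqVneq => [<-|ts].
  have [_ /(_ t)[_ _ /(_ a b)]] := Qiid; rewrite !coordE.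
  rewrite (covarianceE (coord_L1 _) (coord_L1 _)
    (Lfun2_mul_Lfun1 (coord_L2 _) (coord_L2 _))) !coord_mean => h.
  by rewrite EFinD -h EFinM subeK.
rewrite add0r expectationM_indep//.
- by rewrite !coord_mean EFinM.
- exact: measurable_coord.
- exact: measurable_coord.
move=> A B mA mB; have [[msub indep _] _] := Qiid.
(* Events about one coordinate of one block, so that block independence for the list [[:: t; s]]
   gives independence of the two coordinates. *)
pose F (u : 'I_N) : set (borelV R nw) := if u == t
  then (fun z : borelV R nw => (z : 'cV[R]_nw) a 0) @^-1` A
  else (fun z : borelV R nw => (z : 'cV[R]_nw) b 0) @^-1` B.
have mF u : measurable (F u).
  rewrite /F; case: eqP => _; rewrite -[X in measurable X]setTI.
    exact: measurable_coord.
  exact: measurable_coord.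
have := indep [:: t; s] F; rewrite /= inE ts => /(_ isT mF).
rewrite !big_cons big_nil mule1 /F eqxx (eq_sym s t) (negbTE ts).
rewrite -!coordE => <-; congr (Q _); apply/seteqP; split=> xi /=.
  by move=> [xiA xiB] u /=; rewrite !inE => /orP[] /eqP ->;
    rewrite ?eqxx// eq_sym (negbTE ts).
move=> h; split; first by have := h t; rewrite /= inE eqxx; exact.
by have := h s; rewrite /= !inE eqxx orbT eq_sym (negbTE ts); exact.
Qed.

Let ext (xi : T) : 'cV[R]_(1 + stk N nw) := col_mx 1%:M (xi : 'cV[R]_(stk N nw)).
Let extc i (xi : T) : R := ext xi i 0.
Let m := ext_mean N mu.
Let V := ext_cov N Sigma.

Let ext_L2 i : extc i \in Lfun Q 2%:E.
Proof.
case: (split_ordP i) => j ->.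
  rewrite (_ : extc _ = cst 1); first exact: Lfun_cst.
  by apply/funext => xi; rewrite /extc /ext col_mxEu (ord1 j) mxE.
rewrite (_ : extc _ = coord j)//.
by apply/funext => xi; rewrite /extc /ext col_mxEd.
Qed.

(** The leading coordinate is the constant 1, with mean 1 and zero covariances, so the first moments
    of [xi] appear among the second moments of the extended vector. *)
Let ext_second i j : ('E_Q[extc i * extc j] = (V i j + m i 0 * m j 0)%:E)%E.
Proof.
have extl (k : 'I_1) : extc (lshift _ k) = cst 1.
  by apply/funext => xi; rewrite /extc /ext col_mxEu (ord1 k) mxE.
have extr k : extc (rshift 1 k) = coord k.
  by apply/funext => xi; rewrite /extc /ext col_mxEd.
have ml (k : 'I_1) : m (lshift _ k) 0 = 1.
  by rewrite /m /ext_mean col_mxEu (ord1 k) mxE.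
have mr t a : m (rshift 1 (rk t a)) 0 = mu a 0.
  rewrite /m /ext_mean col_mxEd.
  by have := congr1 (fun z : 'cV[R]_nw => z a 0) (mxcolK (fun=> mu) t); rewrite mxE.
have Vr t a s b : V (rshift 1 (rk t a)) (rshift 1 (rk s b)) =
    if t == s then Sigma a b else 0.
  rewrite /V /ext_cov block_mxEdr.
  have := congr1 (fun z : 'M[R]_nw => z a b)
    (mxblockK (fun t s : 'I_N => if t == s then conform_mx 0 Sigma else 0) t s).
  by rewrite mxE => ->; case: ifP => _; rewrite ?conform_mx_id// mxE.
have Vl (k : 'I_1) j' : V (lshift _ k) j' = 0.
  by case: (split_ordP j') => l ->; rewrite /V /ext_cov ?block_mxEul ?block_mxEur mxE.
have Vl' (k : 'I_1) j' : V j' (lshift _ k) = 0.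
  by case: (split_ordP j') => l ->; rewrite /V /ext_cov ?block_mxEul ?block_mxEdl mxE.
case: (split_ordP i) => i' ->; case: (split_ordP j) => j' ->.
- rewrite !extl !ml Vl mulr1 add0r (_ : cst 1 * cst 1 = cst 1); last first.
    by apply/funext => xi; rewrite /= mulr1.
  by rewrite expectation_cst.
- rewrite extl extr ml Vl mul1r add0r; have [t [a ->]] := rkE j'.
  rewrite (_ : cst 1 * _ = coord (rk t a)) ?coord_mean ?mr//.
  by apply/funext => xi; rewrite /= mul1r.
- rewrite extl extr ml Vl' mulr1 add0r; have [t [a ->]] := rkE i'.
  rewrite (_ : _ * cst 1 = coord (rk t a)) ?coord_mean ?mr//.
  by apply/funext => xi; rewrite /= mulr1.
- have [t [a ->]] := rkE i'; have [s [b ->]] := rkE j'.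
  by rewrite !extr !mr Vr coord_second.
Qed.

Lemma iid_qform_expectation (M : 'M[R]_(1 + stk N nw)) :
  (fun xi : T => qform M (ext xi)) \in Lfun Q 1%E /\
  ('E_Q[fun xi => qform M (ext xi)]
    = (\tr (M *m ext_cov N Sigma) + qform M (ext_mean N mu))%:E)%E.
Proof.
have qE (z : 'cV[R]_(1 + stk N nw)) :
    qform M z = \sum_i \sum_j M i j * (z i 0 * z j 0).
  rewrite /qform mxE exchange_big/=; apply: eq_bigr => j _.
  rewrite mxE mulr_suml; apply: eq_bigr => i _; rewrite mxE; ring.
have -> : (fun xi : T => qform M (ext xi)) =
    (fun xi => \sum_i (fun xi => \sum_j (M i j \o* (extc i * extc j)) xi) xi).
  apply/funext => xi; rewrite qE; apply: eq_bigr => i _; apply: eq_bigr => j _.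
  by rewrite /= mulrC.
have L1 i j : extc i * extc j \in Lfun Q 1%E by exact: (Lfun2_mul_Lfun1 (ext_L2 i) (ext_L2 j)).
have L1M i j : M i j \o* (extc i * extc j) \in Lfun Q 1%E by exact: Lfun_scale.
have h i := expectation_sum_fin (L1M i).
have [hL hE] := expectation_sum_fin (fun i => (h i).1).
split=> //; rewrite hE.
(* The trace pairs [M i j] with [V j i]. Symmetry is read off from the second moments, as the
   factors commute. *)
have Vsym i j : V j i = V i j.
  have : ('E_Q[extc i * extc j] = 'E_Q[extc j * extc i])%E by rewrite mulrC.
  by rewrite !ext_second => -[]; rewrite mulrC => /addIr.
rewrite (eq_bigr (fun i => (\sum_j M i j * (V i j + m i 0 * m j 0))%:E)); last first.
  move=> i _; rewrite (h i).2 -sumEFin; apply: eq_bigr => j _.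
  by rewrite expectationZl// ext_second EFinM.
rewrite sumEFin qE /mxtrace -big_split/=; congr (_%:E); apply: eq_bigr => i _.
rewrite [X in _ = X + _]mxE -big_split/=; apply: eq_bigr => j _.
by rewrite mulrDr -/V Vsym.
Qed.

End iid_moments.

(** The window law is the image of [P] under stacking, so independence, equality in law and moments
    of the blocks are pulled back to those of the process at the times [k + t]. *)
Lemma iid_window_law (R : realType) (nw N k : nat) (mu : 'cV[R]_nw)
    (Sigma : 'M[R]_nw) d (Om : measurableType d) (P : probability Om R)
    (w : nat -> Om -> borelV R nw) (Q : probability (borelV R (stk N nw)) R) :
  iid P w -> (forall t, has_mean_cov P (w t) mu Sigma) ->
  (forall S : set (borelV R (stk N nw)), measurable S ->
     Q S = P ((fun om => \mxcol_(t < N) (w (k + t)%N om : 'cV[R]_nw)) @^-1` S)) ->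
  iid_laws mu Sigma Q.
Proof.
move=> [mw indep same] mc QE.
pose stack om : borelV R (stk N nw) := \mxcol_(t < N) (w (k + t)%N om : 'cV[R]_nw).
have stackE om (t : 'I_N) : submxcol (stack om : 'cV[R]_(stk N nw)) t = w (k + t)%N om.
  by rewrite mxcolK.
have msub (t : 'I_N) : measurable_fun [set: borelV R (stk N nw)]
    (fun xi => submxcol (xi : 'cV[R]_(stk N nw)) t : borelV R nw).
  apply: measurable_cVP => // i.
  rewrite (_ : (fun s => _) = (fun s : borelV R (stk N nw) =>
    (s : 'cV[R]_(stk N nw)) (tagnat.Rank t i) 0)); first exact: measurable_coord.
  by apply/funext => xi; rewrite mxE.
have mstack : measurable_fun [set: Om] stack.
  apply: measurable_cVP => // i.
  rewrite (_ : (fun s => _) = (fun om =>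
      (w (k + tagnat.sig1 i)%N om : 'cV[R]_nw) (tagnat.sig2 i) 0)).
    exact: (measurableT_comp (measurable_coord _) (mw _)).
  by apply/funext => om; rewrite /stack mxE.
have msubS (t : 'I_N) (F : set (borelV R nw)) : measurable F ->
    measurable ((fun xi : borelV R (stk N nw) =>
      submxcol (xi : 'cV[R]_(stk N nw)) t : borelV R nw) @^-1` F).
  by move=> mF; rewrite -[X in measurable X]setTI; exact: msub.
have QsubE (t : 'I_N) (F : set (borelV R nw)) : measurable F ->
    Q ((fun xi : borelV R (stk N nw) =>
      submxcol (xi : 'cV[R]_(stk N nw)) t : borelV R nw) @^-1` F) =
    P (w (k + t)%N @^-1` F).
  move=> mF; rewrite QE; last exact: msubS.
  by congr (P _); apply/seteqP; split=> om /=; rewrite mxcolK.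
split; first split => //.
- move=> J F uJ mF.
  (* The events reindexed by absolute time. Only the values at the times [k + t] enter, where [F']
     is [F t]. *)
  pose F' (s : nat) := oapp F setT (insub (s - k)%N).
  have F'E (t : 'I_N) : F' (k + t)%N = F t by rewrite /F' addKn valK.
  have mF' s : measurable (F' s).
    by rewrite /F'; case: insub => [t|] /=; [exact: mF | exact: measurableT].
  have uJ' : uniq [seq (k + val t)%N | t : 'I_N <- J].
    by rewrite map_inj_uniq// => s t /addnI/val_inj.
  rewrite QE; last first.
    by apply: fin_bigcap_measurable => [|t _]; [exact: finite_finset | exact: msubS].
  have := indep _ F' uJ' mF'; rewrite big_map => h.
  rewrite (eq_bigr (fun t : 'I_N => P (w (k + t)%N @^-1` F' (k + t)%N))).
    rewrite -h; congr (P _); apply/seteqP; split => om /= omP.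
      by move=> _ /= /mapP[t tJ ->]; rewrite /= F'E -stackE; exact: omP.
    move=> t tJ; rewrite /= stackE -F'E; apply: omP => /=.
    by apply/mapP; exists t.
  by move=> t _; rewrite F'E QsubE.
- by move=> t s F mF; rewrite !QsubE//; exact: same.
move=> t; have [L2 mean cov] := mc (k + t)%N.
have mcomp i : measurable_fun [set: borelV R (stk N nw)]
    (fun xi => submxcol (xi : 'cV[R]_(stk N nw)) t i 0).
  exact: (measurableT_comp (measurable_coord i) (msub t)).
have compE i : (fun xi : borelV R (stk N nw) => submxcol (xi : 'cV[R]_(stk N nw)) t i 0)
    \o stack = fun om => (w (k + t)%N om : 'cV[R]_nw) i 0.
  by apply/funext => om /=; rewrite mxcolK.
split=> [i|i|i j].
- by apply: (law_Lfun2 mstack QE) => //; rewrite compE.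
- by rewrite (law_expectation mstack QE)// compE.
- by rewrite (law_covariance mstack QE)// !compE.
Qed.

(** * Convexity and the reformulation *)

(** Domination together with attainment identifies [f] with a finite maximum of measurable
    functions. *)
Lemma measurable_max_affine (R : realType) n (T : finType) (t0 : T)
    (a : T -> 'cV[R]_n) (b : T -> R) (f : 'cV[R]_n -> R) :
  (forall xi t, b t + dotv (a t) xi <= f xi) ->
  (forall xi, exists t, f xi = b t + dotv (a t) xi) ->
  measurable_fun [set: borelV R n] (f : borelV R n -> R).
Proof.
move=> f_ub f_max.
pose F t (xi : borelV R n) := b t + dotv (a t) xi.
have mF t : measurable_fun [set: borelV R n] (F t).
  by apply: measurable_funD => //; exact: measurable_dotv.
have -> : f = fun xi => \big[Num.max/F t0 xi]_(t : T) F t xi.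
  apply/funext => xi; apply/eqP; rewrite eq_le; apply/andP; split.
    by have [t ->] := f_max xi; exact: le_bigmax_cond.
  by apply/bigmax_leP; split=> [|t _]; exact: f_ub.
rewrite unlock; elim: (index_enum T) => [|t s IH] /=; first exact: mF.
exact: measurable_maxr.
Qed.

Section convexity.
Context {R : realType}.

(** The gap between the two sides is [l * (1 - l) * qform S (y - z)]. *)
Lemma qform_convex n (S : 'M[R]_n) (l : R) (y z : 'cV[R]_n) :
  (forall v, 0 <= qform S v) -> 0 <= l <= 1 ->
  qform S (l *: y + (1 - l) *: z) <= l * qform S y + (1 - l) * qform S z.
Proof.
move=> S0 /andP[l0 l1].
pose bil (u v : 'cV[R]_n) := (u^T *m S *m v) 0 0.
have E u v a b : qform S (a *: u + b *: v) =
    a ^+ 2 * qform S u + b ^+ 2 * qform S v + a * b * (bil u v + bil v u).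
  rewrite /qform /bil.
  have -> : (a *: u + b *: v)^T = a *: u^T + b *: v^T by rewrite linearD/= !linearZ.
  rewrite !(mulmxDl, mulmxDr) -!scalemxAl -!scalemxAr -?scalemxAl.
  set p := u^T *m S *m u; set r := v^T *m S *m u.
  set p' := u^T *m S *m v; set r' := v^T *m S *m v.
  by rewrite !mxE; ring.
have := mulr_ge0 (mulr_ge0 l0 (_ : 0 <= 1 - l)) (S0 (1 *: y + (-1) *: z)).
rewrite subr_ge0 => /(_ l1); rewrite !E; lra.
Qed.

Context {nx nu ny nw N : nat}.
Variables (sys : lti R nx nu ny nw) (x : 'cV[R]_nx) (c : cost_data R nx nu).
Hypothesis c_ok : cost_data_ok c.

Lemma tildeH_conv (l : R) (H1 H2 : law R nu ny N) :
  tildeH sys x (l *: H1 + (1 - l) *: H2) =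
  l *: tildeH sys x H1 + (1 - l) *: tildeH sys x H2.
Proof. by rewrite /tildeH mulmxDl -!scalemxAl. Qed.

(** The offset [tildeCx] is reproduced because the two weights add up to one. *)
Lemma state_map_conv (l : R) (H1 H2 : law R nu ny N) :
  state_map sys x (l *: H1 + (1 - l) *: H2) =
  l *: state_map sys x H1 + (1 - l) *: state_map sys x H2.
Proof.
rewrite /state_map tildeH_conv mulmxDr -!scalemxAr !scalerDr addrACA.
by rewrite -scalerDl [l + _]addrC subrK scale1r.
Qed.

Lemma coefa_conv (l : R) (H1 H2 : law R nu ny N) t i :
  coefa sys x (l *: H1 + (1 - l) *: H2) t i =
  l *: coefa sys x H1 t i + (1 - l) *: coefa sys x H2 t i.
Proof. by rewrite /coefa /state_row state_map_conv; apply/colP => j; rewrite !mxE. Qed.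

Lemma coefb_conv (l : R) (H1 H2 : law R nu ny N) t i :
  coefb sys x (l *: H1 + (1 - l) *: H2) t i =
  l * coefb sys x H1 t i + (1 - l) * coefb sys x H2 t i.
Proof. by rewrite /coefb /state_row state_map_conv !mxE. Qed.

Lemma causal_conv (l : R) (H1 H2 : law R nu ny N) :
  causal H1 -> causal H2 -> causal (l *: H1 + (1 - l) *: H2).
Proof.
move=> c1 c2 t s ts; have := c1 t s ts; have := c2 t s ts.
move=> /matrixP h2 /matrixP h1; apply/matrixP => i j.
by have := h1 i j; have := h2 i j; rewrite !mxE => -> ->; rewrite !mulr0 addr0.
Qed.

Lemma stM_qformE (HN : law R nu ny N) z : qform (stM sys x c HN) z =
  qform (stJx N c) (state_map sys x HN *m z) + qform (stJu N c) (tildeH sys x HN *m z).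
Proof. by rewrite /stM qformD !qform_congr. Qed.

Lemma stJx_ge0 z : 0 <= qform (stJx N c) z.
Proof.
have [/andP[b0 _] [_ Q0] [_ Qf0] _] := c_ok.
rewrite qform_mxdiag sumr_ge0// => t _.
by case: ifP => _; rewrite qformZ mulr_ge0// exprn_ge0// ltW.
Qed.

Lemma stJu_ge0 z : 0 <= qform (stJu N c) z.
Proof.
have [/andP[b0 _] _ _ [_ R0]] := c_ok.
rewrite qform_mxdiag sumr_ge0// => t _; rewrite qformZ mulr_ge0//.
  by rewrite exprn_ge0// ltW.
have [->|z0] := eqVneq (submxcol z t) 0; last by rewrite ltW// R0.
by rewrite /qform mulmx0 mxE.
Qed.

Lemma stM_qform_convex (l : R) (H1 H2 : law R nu ny N) z : 0 <= l <= 1 ->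
  qform (stM sys x c (l *: H1 + (1 - l) *: H2)) z <=
  l * qform (stM sys x c H1) z + (1 - l) * qform (stM sys x c H2) z.
Proof.
move=> l01; rewrite !stM_qformE state_map_conv tildeH_conv !(mulmxDl (l *: _)) -!scalemxAl.
rewrite !mulrDr addrACA lerD//.
  by apply: (qform_convex _ _ _ l01); exact: stJx_ge0.
by apply: (qform_convex _ _ _ l01); exact: stJu_ge0.
Qed.

(** As the cost is an expectation under [Q], the convexity of the integrand at each [xi] can be
    integrated. *)
Lemma cp_cost_convex (mu : 'cV[R]_nw) (Sigma : 'M[R]_nw)
    (Q : probability (borelV R (stk N nw)) R) (l : R) (H1 H2 : law R nu ny N) :
  iid_laws mu Sigma Q -> 0 <= l <= 1 ->
  cp_cost sys x c mu Sigma (l *: H1 + (1 - l) *: H2) <=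
  l * cp_cost sys x c mu Sigma H1 + (1 - l) * cp_cost sys x c mu Sigma H2.
Proof.
move=> Qiid l01.
pose f H (xi : borelV R (stk N nw)) :=
  qform (stM sys x c H) (col_mx 1%:M (xi : 'cV[R]_(stk N nw))).
have fL H : f H \in Lfun Q 1%E by have [] := iid_qform_expectation Qiid (stM sys x c H).
have fE H : ('E_Q[f H] = (cp_cost sys x c mu Sigma H)%:E)%E.
  by have [] := iid_qform_expectation Qiid (stM sys x c H).
have ZL a H : a \o* f H \in Lfun Q 1%E by exact: Lfun_scale.
rewrite -lee_fin [leRHS]EFinD [X in (X + _)%E]EFinM [X in (_ + X)%E]EFinM.
rewrite -!fE -!expectationZl// -expectationD//.
rewrite unlock; apply: le_integral => //.
- exact/Lfun1_integrable.
- by apply/Lfun1_integrable; exact: rpredD.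
- by move=> xi _; rewrite lee_fin /= ![f _ _ * _]mulrC; exact: stM_qform_convex.
Qed.

End convexity.

(** * Equivalence of the feasible sets and convexity of the program *)

Section program.
Context {R : realType} {nx nu ny nw N Nb Ns q : nat}.
Variables (sys : lti R nx nu ny nw) (x : 'cV[R]_nx).
Hypothesis N_gt0 : (0 < N)%N.

Lemma ell_ge (HN : law R nu ny N) i xi (t : 'I_N) : causal HN ->
  coefb sys x HN t i + dotv (coefa sys x HN t i) xi <= ell sys i x HN xi.
Proof.
move=> HNc; rewrite -state_affine// /ell big_add1/= big_mkord.
exact: (le_bigmax_cond _ (fun t : 'I_N => state sys x HN xi t.+1 i 0)).
Qed.

Lemma ell_attained (HN : law R nu ny N) i xi : causal HN ->
  exists t : 'I_N,
    ell sys i x HN xi = coefb sys x HN t i + dotv (coefa sys x HN t i) xi.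
Proof.
move=> HNc; suff [t tE] : exists t : 'I_N, ell sys i x HN xi = state sys x HN xi t.+1 i 0.
  by exists t; rewrite tE state_affine.
rewrite /ell big_add1/= big_mkord.
(* The default value of the maximum is the state at time 1, the term of index 0, which exists
   because [N > 0]. *)
elim/big_ind : _ => [|y z [t ->] [s ->]|t _]; first by exists (Ordinal N_gt0).
  by case: leP => _; [exists s | exists t].
by exists t.
Qed.

Variable nrm : 'cV[R]_(stk N nw) -> R.
Hypothesis nrmP : is_norm nrm.
Variables (Cxi : 'M[R]_(q, stk N nw)) (dxi : 'cV[R]_q).
Variables (sample : 'I_Ns -> 'cV[R]_(stk N nw)) (alpha eps : R).
Variables (m : 'I_Nb -> 'I_nx) (U : 'I_Nb -> R).
Hypotheses (Ns_gt0 : (0 < Ns)%N) (eps_gt0 : 0 < eps).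
Hypothesis sampleP : forall i, polytope Cxi dxi (sample i).

Let ball := wball nrm (polytope Cxi dxi) alpha eps sample.
Let cp := cp_feasible sys x nrm Cxi dxi eps sample m U.

(** For a fixed law the constraints decouple over [j]; the multipliers are chosen for each [j] and
    then collected into the matrix variables. *)
Lemma dr_feasibleP (HN : law R nu ny N) :
  dr_feasible sys x ball m U HN <-> exists lambda s gamma, cp (HN, lambda, s, gamma).
Proof.
have wcP (j : 'I_Nb) : causal HN -> _ := fun HNc => worst_case_expectationP nrmP
    Ns_gt0 sampleP (Ordinal N_gt0)
    (measurable_max_affine (Ordinal N_gt0)
      (fun xi t => ell_ge (m j) xi t HNc) (fun xi => ell_attained (m j) xi HNc))
    (fun xi t => ell_ge (m j) xi t HNc) (fun xi => ell_attained (m j) xi HNc)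
    alpha (U j) eps_gt0.
split=> [[HNc HNU]|[lambda [s [gamma [HNc sU gP]]]]].
  have /choice[f fP] j : exists lsg : R * ('I_Ns -> R) * ('I_Ns -> 'I_N -> 'cV[R]_q),
    lsg.1.1 * eps + Ns%:R^-1 * \sum_i lsg.1.2 i <= U j /\
    forall i t, [/\ coefb sys x HN t (m j) + dotv (coefa sys x HN t (m j)) (sample i)
                      + dotv (lsg.2 i t) (dxi - Cxi *m sample i) <= lsg.1.2 i,
      dual_norm nrm (Cxi^T *m lsg.2 i t - coefa sys x HN t (m j)) <= lsg.1.1 &
      forall l, 0 <= lsg.2 i t l 0].
    have [l [s [g h]]] : _ := (wcP j HNc).1 (fun Q Qball =>
      le_trans (ereal_sup_ubound (ex_intro2 _ _ Q Qball erefl)) (HNU j)).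
    by exists (l, s, g).
  exists (\row_j (f j).1.1), (\matrix_(i, j) (f j).1.2 i),
    [ffun z => (f z.1.2).2 z.1.1 z.2].
  split=> // [j|i j t].
    by rewrite mxE; under eq_bigr do rewrite mxE; have [] := fP j.
  by rewrite !mxE ffunE /=; have [_ /(_ i t)] := fP j.
split=> // j; apply: ge_ereal_sup => _ [Q Qball <-].
apply: (wcP j HNc).2 Q Qball; exists (lambda 0 j), (s^~ j), (fun i t => gamma (i, j, t)).
by split=> // i t; exact: gP.
Qed.

(** The coefficients [coefa] and [coefb] are affine in the law, the slack term is linear in [gamma],
    and the dual norm is convex, so all constraints pass to convex combinations. *)
Lemma cp_feasible_conv (a : R) (H1 H2 : law R nu ny N) (l1 l2 : 'rV[R]_Nb)
    (s1 s2 : 'M[R]_(Ns, Nb)) (g1 g2 : {ffun 'I_Ns * 'I_Nb * 'I_N -> 'cV[R]_q}) :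
  0 <= a -> 0 <= 1 - a -> cp (H1, l1, s1, g1) -> cp (H2, l2, s2, g2) ->
  cp (a *: H1 + (1 - a) *: H2, a *: l1 + (1 - a) *: l2,
      a *: s1 + (1 - a) *: s2, a *: g1 + (1 - a) *: g2).
Proof.
move=> a0 b0 [c1 u1 d1] [c2 u2 d2].
have conv_le (r1 r2 t1 t2 : R) : r1 <= t1 -> r2 <= t2 ->
    a * r1 + (1 - a) * r2 <= a * t1 + (1 - a) * t2.
  by move=> h1 h2; rewrite lerD// ler_wpM2l.
split.
- exact: causal_conv.
- move=> j; rewrite !mxE; under eq_bigr do rewrite !mxE.
  rewrite big_split/= -!mulr_sumr.
  have UE : a * U j + (1 - a) * U j = U j by ring.
  have := conv_le _ _ _ _ (u1 j) (u2 j); rewrite UE; apply: le_trans.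
  by rewrite le_eqVlt; apply/orP; left; apply/eqP; ring.
- move=> i j t; have [p1 q1 r1] := d1 i j t; have [p2 q2 r2] := d2 i j t.
  rewrite coefa_conv coefb_conv !ffunE; split.
  + rewrite [leRHS]mxE [X in _ <= X + _]mxE [X in _ <= _ + X]mxE.
    rewrite (le_trans _ (conv_le _ _ _ _ p1 p2))// le_eqVlt; apply/orP; left.
    by apply/eqP; rewrite !dotvDl !dotvZl; ring.
  + rewrite mulmxDr -!scalemxAr opprD addrACA -!scalerBr.
    rewrite [leRHS]mxE [X in _ <= X + _]mxE [X in _ <= _ + X]mxE.
    rewrite (le_trans (dual_normD nrmP _ _))// (le_trans _ (conv_le _ _ _ _ q1 q2))//.
    by rewrite lerD// dual_normZ.
  + by move=> l; rewrite !mxE addr_ge0 ?mulr_ge0 ?r1 ?r2.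
Qed.

Lemma cp_feasible_convex : convex_set cp.
Proof.
move=> [[[H1 l1] s1] g1] [[[H2 l2] s2] g2] p /set_mem c1 /set_mem c2.
by apply/mem_set; apply: (@cp_feasible_conv p%:num) c1 c2; rewrite ?subr_ge0.
Qed.

End program.

(** The objective takes its supremum over the laws of the ball that make the disturbances i.i.d.
    with the given moments, the constraints over the whole ball. *)
Theorem theorem4p1 (R : realType) (nx nu ny nw N Nb Ns q k : nat)
    (sys : lti R nx nu ny nw) (x : 'cV[R]_nx) (c : cost_data R nx nu)
    (m : 'I_Nb -> 'I_nx) (U : 'I_Nb -> R)
    (nrm : 'cV[R]_(stk N nw) -> R)
    (Cxi : 'M[R]_(q, stk N nw)) (dxi : 'cV[R]_q)
    (sample : 'I_Ns -> 'cV[R]_(stk N nw)) (alpha eps : R)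
    (mu : 'cV[R]_nw) (Sigma : 'M[R]_nw)
    (d : measure_display) (Om : measurableType d) (P : probability Om R)
    (w : nat -> Om -> borelV R nw)
    (Pxi : probability (borelV R (stk N nw)) R)
    (N_gt0 : (0 < N)%N) (Ns_gt0 : (0 < Ns)%N)
    (c_ok : cost_data_ok c) (nrmP : is_norm nrm)
    (eps_gt0 : 0 < eps) (alpha_gt0 : 0 < alpha)
    (sampleP : forall i, polytope Cxi dxi (sample i))
    (w_iid : iid P w)
    (w_mean_cov : forall t, has_mean_cov P (w t) mu Sigma)
    (PxiE : forall S : set (borelV R (stk N nw)), measurable S ->
       Pxi S = P ((fun om => \mxcol_(t < N) (w (k + t)%N om : 'cV[R]_nw))
                    @^-1` S))
    (Pxi_ball : wball nrm (polytope Cxi dxi) alpha eps sample Pxi) :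
  let ball := wball nrm (polytope Cxi dxi) alpha eps sample in
  let ball_iid := ball `&` iid_laws mu Sigma in
  let obj := cp_cost sys x c mu Sigma in
  let cp := cp_feasible sys x nrm Cxi dxi eps sample m U in
  [/\ forall HN, causal HN -> dr_cost sys x c ball_iid HN = (obj HN)%:E,
      forall HN, dr_feasible sys x ball m U HN <->
        exists lambda s gamma, cp (HN, lambda, s, gamma),
      ereal_inf [set dr_cost sys x c ball_iid HN
                | HN in dr_feasible sys x ball m U]
        = ereal_inf [set (obj z.1.1.1)%:E | z in cp],
      convex_set cp &
      convex_function cp (fun z => obj z.1.1.1)].
Proof.
move=> ball ball_iid obj cp.
have Pxi_iid : iid_laws mu Sigma Pxi by exact: iid_window_law w_iid w_mean_cov PxiE.
have costE HN : causal HN -> dr_cost sys x c ball_iid HN = (obj HN)%:E.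
  move=> HNc.
  have EE Q : iid_laws mu Sigma Q -> ('E_Q[cost sys c x HN] = (obj HN)%:E)%E.
    move=> Qiid; have [_ <-] := iid_qform_expectation Qiid (stM sys x c HN).
    by congr expectation; apply/funext => xi; rewrite cost_qform.
  (* The expectations form a singleton: all these laws give the same value, and [Pxi] is one of
     them. *)
  rewrite /dr_cost [X in ereal_sup X](_ : _ = [set (obj HN)%:E]) ?ereal_sup1//.
  apply/seteqP; split=> [_ [Q [_ Qiid] <-]|_ ->]; first exact: EE.
  by exists Pxi; [split | exact: EE].
have feasE HN : dr_feasible sys x ball m U HN <->
    exists lambda s gamma, cp (HN, lambda, s, gamma) by exact: dr_feasibleP.
split=> //.
- congr ereal_inf; apply/seteqP; split=> [_ [HN HNf <-]|_ [[[[HN l] s] g] cpz <-]].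
    have [l [s [g cpz]]] := (feasE HN).1 HNf.
    by exists (HN, l, s, g) => //=; rewrite costE//; case: HNf.
  have HNf : dr_feasible sys x ball m U HN by apply/feasE; exists l, s, g.
  by exists HN => //=; rewrite costE//; case: HNf.
- exact: cp_feasible_convex.
- move=> p [[[H1 l1] s1] g1] [[[H2 l2] s2] g2] _ _.
  apply: (cp_cost_convex sys x c_ok H1 H2 Pxi_iid (l := p%:num)).
  by apply/andP.
Qed.
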